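(* Let $\alpha\in[0,1)$ and let $f=h+\overline{g}\in\check{L}_H^{\alpha}$. Then for all $z\in\Delta$, $$|g(z)| \geq\begin{cases}\displaystyle\frac{|z|(\alpha-|z|)}{(1-\alpha |z|)(1+|z|)^2},& |z|<\alpha,\\[8pt] 0, & |z|\geq\alpha,\end{cases}$$ and $$|g(z)|\leq \left(\frac{1-\alpha}{1+\alpha}\right)^2\log{\frac{1+\alpha |z|}{1-|z|}}+\frac{|z|}{(1-|z|)^2}-\left(\frac{1-\alpha}{1+\alpha}\right)\frac{2|z|}{1-|z|}\leq \frac{|z|(\alpha+|z|)}{(1+\alpha |z|)(1-|z|)^2}.$$
   Context: $\Delta$ is the open unit disc in $\mathbb{C}$. Every complex-valued harmonic function $f$ in $\Delta$ is uniquely represented as $f=h+\overline{g}$ with $h,g$ analytic in $\Delta$ and $g(0)=0$; write $h(z)=\sum_{n=0}^\infty a_nz^n$, $g(z)=\sum_{n=1}^\infty b_nz^n$. The Jacobian of $f$ is $J_f(z)=|h'(z)|^2-|g'(z)|^2$; $f$ is locally one-to-one and sense-preserving in $\Delta$ if and only if $J_f(z)>0$ for all $z\in\Delta$. $L_H$ denotes the set of all locally one-to-one and sense-preserving harmonic functions $f=h+\overline{g}$ in $\Delta$ with $h(0)=0$, $h'(0)=1$ (and $g(0)=0$). A starlike analytic function is a one-to-one analytic function in $\Delta$ fixing $0$ whose image is starlike with respect to the origin. For $\alpha\in[0,1)$, $\check{L}_H^{\alpha}$ is the class of all $f=h+\overline{g}\in L_H$ such that $|b_1|=|g'(0)|=\alpha$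 and $h$ is a starlike analytic function. $\log$ is the natural logarithm. *)

(* Defs.v *)
From Stdlib Require Import Reals.
From Coquelicot Require Import Coquelicot.
Local Open Scope R_scope.

(* Functions on the unit disc are total functions [C -> C]; their values
   outside [unit_disc] are never constrained. *)
Definition unit_disc (z : C) : Prop := Cmod z < 1.

(* Complex differentiability: the base field is forced to be C, since
   [ex_derive] is also available over R. *)
Definition analytic_unit_disc (h : C -> C) : Prop :=
  forall z : C, unit_disc z -> @ex_derive C_AbsRing C_NormedModule h z.

(* f = h + conj g, the canonical representation of a harmonic function. *)
Definition harmonic_rep (f h g : C -> C) : Prop :=
  analytic_unit_disc h /\ analytic_unit_disc g /\ g (RtoC 0) = RtoC 0 /\
  forall z : C, unit_disc z -> f z = Cplus (h z) (Cconj (g z)).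

(* [C_derive] is a limit along the real direction only; it is the complex
   derivative wherever [ex_derive] holds over C ([C_derive_correct]). *)
Definition jacobian (h g : C -> C) (z : C) : R :=
  Cmod (C_derive h z) ^ 2 - Cmod (C_derive g z) ^ 2.

Definition locally_injective (f : C -> C) : Prop :=
  forall z : C, unit_disc z ->
  exists eps : posreal, forall w1 w2 : C,
    unit_disc w1 -> unit_disc w2 ->
    Cmod (Cminus w1 z) < eps -> Cmod (Cminus w2 z) < eps ->
    f w1 = f w2 -> w1 = w2.

Definition sense_preserving (h g : C -> C) : Prop :=
  forall z : C, unit_disc z -> 0 < jacobian h g z.

(* [L_H f h g]: f is in the class L_H, with canonical representation
   f = h + conj g. *)
Definition L_H (f h g : C -> C) : Prop :=
  harmonic_rep f h g /\
  locally_injective f /\ sense_preserving h g /\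
  h (RtoC 0) = RtoC 0 /\ C_derive h (RtoC 0) = RtoC 1.

Definition image_unit_disc (h : C -> C) (w : C) : Prop :=
  exists z : C, unit_disc z /\ h z = w.

Definition starlike_origin (D : C -> Prop) : Prop :=
  forall (w : C) (t : R), D w -> 0 <= t <= 1 -> D (Cmult (RtoC t) w).

Definition starlike_analytic (h : C -> C) : Prop :=
  analytic_unit_disc h /\
  (forall z1 z2 : C, unit_disc z1 -> unit_disc z2 -> h z1 = h z2 -> z1 = z2) /\
  h (RtoC 0) = RtoC 0 /\
  starlike_origin (image_unit_disc h).

Definition L_H_starlike (alpha : R) (f h g : C -> C) : Prop :=
  L_H f h g /\
  Cmod (C_derive g (RtoC 0)) = alpha /\
  starlike_analytic h.

(* Main.v *)
(** Starlikeness lets [k = h^-1] be applied to [t h(z)] for [0 <= t <= 1], and [z |-> k (t h(z))]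
    maps the disc into itself and fixes 0.  Schwarz-Pick for [k (t h(z)) / z], whose value at 0 is
    [t], gives as [t -> 1] the bound [|q - 1| <= |z| |q + 1|] for [q = z h' / h], hence by
    integration along rays the growth and distortion bounds for [h].  The quotients
    [(g(z) - g(k(t h(z)))) / ((1 - t) h(z))] are means of the dilatation [g' / h'], so they have
    modulus at most 1, and their value at 0 is [g'(0)].  Schwarz-Pick for them gives at [t = 0] the
    lower bound for [|g / h|], and as [t -> 1] the upper bound for [|g' / h'|], which is integrated
    along a ray together with the distortion bound.  Working with secants makes it unnecessary to
    know that derivatives of holomorphic functions are holomorphic: the only complex analysis needed
    is the maximum principle, which comes from Goursat's lemma in polar coordinates. *)
Require Import Defs.
From Stdlib Require Import Reals Lra Psatz Classical ClassicalEpsilon.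
From Coquelicot Require Import Coquelicot.
Local Open Scope R_scope.

(** * Complex continuity and differentiability *)

(** Every function given to the Schwarz-Pick lemma is a quotient, such as [k (t h(z)) / z], known to
    be continuous at 0 and to have a derivative elsewhere. Removing the singularity would require
    the regularity theory that is being avoided. The mean value property, the maximum principle and
    the Schwarz lemma are therefore stated for continuous functions with a derivative off isolated
    exceptional points, and Caratheodory's slope function supplies the value of a quotient at its
    base point. The same slopes, taken at [u = 1] for a complex parameter [u] replacing [t], turn
    the limit [t -> 1] into continuity at one point. The expressions in the upper bound have a
    common origin. Put [omega(s) = (alpha + s) / (1 + alpha s)] and [K(s) = s / (1 - s)^2]. Then
    [omega] bounds [|g' / h'|] and [K'] bounds [|h'|]; the middle expression is the primitive of
    [omega K'], the last one is [omega K], and they differ by the integral of [omega' K >= 0]. *)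

Lemma Cmod_sub_sym (a b : C) : Cmod (a - b) = Cmod (b - a).
Proof. rewrite <- Cmod_opp. f_equal. ring. Qed.

Lemma Cmod_sub_ge (a b : C) : Cmod a - Cmod b <= Cmod (a - b).
Proof.
  pose proof (Cmod_triangle (a - b) b) as H.
  replace (a - b + b)%C with a in H by ring. lra.
Qed.

Lemma Cmod_sub_le (a b : C) : Cmod (a - b) <= Cmod a + Cmod b.
Proof.
  pose proof (Cmod_triangle a (- b)) as H. rewrite Cmod_opp in H. exact H.
Qed.

Lemma Cmod_triangle_via (a b c : C) : Cmod (a - c) <= Cmod (a - b) + Cmod (b - c).
Proof.
  pose proof (Cmod_triangle (a - b) (b - c)) as H.
  replace (a - b + (b - c))%C with (a - c)%C in H by ring. exact H.
Qed.

Lemma Cmod_diag (z : C) : Cmod (z - z) = 0.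
Proof. replace (z - z)%C with (RtoC 0) by ring. apply Cmod_0. Qed.

Lemma Cmod_pos (z : C) : z <> RtoC 0 -> 0 < Cmod z.
Proof. apply Cmod_gt_0. Qed.

Lemma Cmod_pos_neq (z : C) : 0 < Cmod z -> z <> RtoC 0.
Proof. apply Cmod_gt_0. Qed.

Lemma Cmod_RtoC_pos (r : R) : 0 <= r -> Cmod (RtoC r) = r.
Proof. intros H. rewrite Cmod_R. apply Rabs_pos_eq, H. Qed.

Definition ccont (f : C -> C) (z : C) : Prop :=
  forall eps : R, 0 < eps ->
  exists d : R, 0 < d /\ forall w : C, Cmod (w - z) < d -> Cmod (f w - f z) < eps.

(** The non-strict inequality, with no division, admits [w = z], so no case distinction is forced on
    users. *)
Definition cderiv (f : C -> C) (z l : C) : Prop :=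
  forall eps : R, 0 < eps ->
  exists d : R, 0 < d /\ forall w : C, Cmod (w - z) < d ->
    Cmod (f w - f z - l * (w - z)) <= eps * Cmod (w - z).

Lemma ccont_const (c z : C) : ccont (fun _ => c) z.
Proof. intros e He. exists 1. split; [lra|]. intros w _. rewrite Cmod_diag. exact He. Qed.

Lemma ccont_id (z : C) : ccont (fun w => w) z.
Proof. intros e He. exists e. split; [exact He|]. intros w H. exact H. Qed.

Lemma ccont_ext_loc (f g : C -> C) (z : C) (r : R) : 0 < r ->
  (forall w, Cmod (w - z) < r -> f w = g w) -> ccont f z -> ccont g z.
Proof.
  intros Hr E F e He. destruct (F e He) as [d [Hd H]].
  exists (Rmin d r). split; [apply Rmin_pos; assumption|].
  intros w Hw. pose proof (Rmin_l d r). pose proof (Rmin_r d r).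
  rewrite <- (E w), <- (E z). apply H. lra. rewrite Cmod_diag; lra. lra.
Qed.

Lemma ccont_ext (f g : C -> C) (z : C) : (forall w, f w = g w) -> ccont f z -> ccont g z.
Proof. intros E. apply (ccont_ext_loc f g z 1). lra. intros w _; apply E. Qed.

Lemma ccont_comp (f g : C -> C) (z : C) :
  ccont f z -> ccont g (f z) -> ccont (fun w => g (f w)) z.
Proof.
  intros F G e He. destruct (G e He) as [d [Hd H]]. destruct (F d Hd) as [d' [Hd' H']].
  exists d'. split; [exact Hd'|]. intros w Hw. apply H, H', Hw.
Qed.

Lemma ccont_plus (f g : C -> C) (z : C) :
  ccont f z -> ccont g z -> ccont (fun w => f w + g w)%C z.
Proof.
  intros F G e He.
  destruct (F (e/2)) as [d [Hd H]]; [lra|]. destruct (G (e/2)) as [d' [Hd' H']]; [lra|].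
  exists (Rmin d d'). split; [apply Rmin_pos; assumption|].
  intros w Hw. pose proof (Rmin_l d d'). pose proof (Rmin_r d d').
  specialize (H w ltac:(lra)). specialize (H' w ltac:(lra)).
  replace (f w + g w - (f z + g z))%C with ((f w - f z) + (g w - g z))%C by ring.
  pose proof (Cmod_triangle (f w - f z) (g w - g z)). lra.
Qed.

Lemma ccont_mult (f g : C -> C) (z : C) :
  ccont f z -> ccont g z -> ccont (fun w => f w * g w)%C z.
Proof.
  intros F G e He.
  set (M := Cmod (f z) + Cmod (g z) + 1).
  assert (HM : 0 < M) by (unfold M; pose proof (Cmod_ge_0 (f z)); pose proof (Cmod_ge_0 (g z)); lra).
  set (k := Rmin 1 (e / (2 * M))).
  assert (Hk : 0 < k) by (unfold k; apply Rmin_pos; [lra|apply Rdiv_lt_0_compat; lra]).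
  destruct (F k Hk) as [d [Hd H]]. destruct (G k Hk) as [d' [Hd' H']].
  exists (Rmin d d'). split; [apply Rmin_pos; assumption|].
  intros w Hw. pose proof (Rmin_l d d'). pose proof (Rmin_r d d').
  specialize (H w ltac:(lra)). specialize (H' w ltac:(lra)).
  replace (f w * g w - (f z * g z))%C
    with ((f w - f z) * (g w - g z) + (f w - f z) * g z + f z * (g w - g z))%C by ring.
  eapply Rle_lt_trans; [eapply Rle_trans; [apply Cmod_triangle|apply Rplus_le_compat_r, Cmod_triangle]|].
  rewrite !Cmod_mult.
  assert (K1 : k <= 1) by apply Rmin_l.
  assert (K2 : k * M <= e / 2).
  { apply Rle_trans with (e / (2 * M) * M). apply Rmult_le_compat_r; [lra|apply Rmin_r].
    right. field. lra. }
  pose proof (Cmod_ge_0 (f z)). pose proof (Cmod_ge_0 (g z)).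
  pose proof (Cmod_ge_0 (f w - f z)). pose proof (Cmod_ge_0 (g w - g z)).
  unfold M in K2. nra.
Qed.

Lemma ccont_minus (f g : C -> C) (z : C) :
  ccont f z -> ccont g z -> ccont (fun w => f w - g w)%C z.
Proof.
  intros F G. apply (ccont_ext (fun w => f w + (- RtoC 1) * g w)%C).
  intros w. ring.
  apply ccont_plus; [exact F|]. apply ccont_mult; [apply ccont_const|exact G].
Qed.

Lemma ccont_lower (f : C -> C) (z : C) : ccont f z -> f z <> RtoC 0 ->
  exists d, 0 < d /\ forall w, Cmod (w - z) < d -> Cmod (f z) / 2 < Cmod (f w).
Proof.
  intros F N. apply Cmod_pos in N. destruct (F (Cmod (f z) / 2)) as [d [Hd H]]; [lra|].
  exists d. split; [exact Hd|]. intros w Hw. specialize (H w Hw).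
  rewrite Cmod_sub_sym in H. pose proof (Cmod_sub_ge (f z) (f w)). lra.
Qed.

Lemma ccont_inv (f : C -> C) (z : C) : ccont f z -> f z <> RtoC 0 ->
  ccont (fun w => / f w)%C z.
Proof.
  intros F N e He. destruct (ccont_lower f z F N) as [d1 [Hd1 H1]].
  apply Cmod_pos in N as P.
  set (m := Cmod (f z)) in *.
  destruct (F (e * (m * m) / 2)) as [d [Hd H]]. { apply Rdiv_lt_0_compat; [|lra]. repeat apply Rmult_lt_0_compat; lra. }
  exists (Rmin d d1). split; [apply Rmin_pos; assumption|].
  intros w Hw. pose proof (Rmin_l d d1). pose proof (Rmin_r d d1).
  specialize (H w ltac:(lra)). specialize (H1 w ltac:(lra)).
  assert (Nw : f w <> RtoC 0) by (apply Cmod_pos_neq; lra).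
  replace (/ f w - / f z)%C with ((f z - f w) * / (f w * f z))%C by (field; auto).
  rewrite Cmod_mult, Cmod_inv, Cmod_mult; [|apply Cmult_neq_0; assumption].
  fold m. rewrite Cmod_sub_sym.
  apply Rmult_lt_reg_r with (Cmod (f w) * m); [nra|].
  rewrite Rmult_assoc, Rinv_l by nra. 
  assert (m * m / 2 < Cmod (f w) * m) by nra.
  assert (e * (m * m / 2) < e * (Cmod (f w) * m)) by (apply Rmult_lt_compat_l; lra).
  lra.
Qed.

Lemma ccont_div (f g : C -> C) (z : C) : ccont f z -> ccont g z -> g z <> RtoC 0 ->
  ccont (fun w => f w / g w)%C z.
Proof. intros F G N. apply ccont_mult; [exact F|apply ccont_inv; assumption]. Qed.

Lemma ccont_Cmod (f : C -> C) (z : C) : ccont f z -> ccont (fun w => RtoC (Cmod (f w))) z.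
Proof.
  intros F e He. destruct (F e He) as [d [Hd H]]. exists d. split; [exact Hd|].
  intros w Hw. specialize (H w Hw). rewrite <- RtoC_minus, Cmod_R.
  pose proof (Cmod_sub_ge (f w) (f z)). pose proof (Cmod_sub_ge (f z) (f w)).
  rewrite Cmod_sub_sym in H1. apply Rabs_def1; lra.
Qed.

(** Caratheodory's criterion: the factorisation holds for every [w], so the calculus rules reduce to
    continuity and algebra; in the chain rule, the case [f w = f z] does not arise. The slope [phi]
    is also the continuous extension of a difference quotient to its base point, which is its main
    use later. *)
Lemma cderiv_carath (f : C -> C) (z l : C) :
  cderiv f z l <-> exists phi, phi z = l /\ ccont phi z /\
    forall w, (f w - f z = phi w * (w - z))%C.
Proof.
  split.
  - intros D. exists (fun w => if Ceq_dec w z then l else ((f w - f z) / (w - z))%C).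
    destruct (Ceq_dec z z) as [_|N]; [|congruence]. split; [reflexivity|]. split.
    + intros e He. destruct (D (e/2)) as [d [Hd H]]; [lra|]. exists d. split; [exact Hd|].
      intros w Hw. destruct (Ceq_dec z z) as [_|N]; [|congruence].
      destruct (Ceq_dec w z) as [E|N]. rewrite Cmod_diag; lra.
      specialize (H w Hw).
      assert (N' : (w - z)%C <> RtoC 0) by (apply Cminus_eq_contra; exact N).
      replace ((f w - f z) / (w - z) - l)%C with ((f w - f z - l * (w - z)) / (w - z))%C
        by (field; exact N').
      rewrite Cmod_div by exact N'. apply Cmod_pos in N'.
      apply Rle_lt_trans with (e / 2); [|lra].
      apply Rle_div_l; [exact N'|exact H].
    + intros w. destruct (Ceq_dec w z) as [E|N]. rewrite E; ring.
      field. apply Cminus_eq_contra; exact N.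
  - intros [phi [E [K H]]] e He. destruct (K e He) as [d [Hd H']]. exists d. split; [exact Hd|].
    intros w Hw. rewrite (H w). rewrite <- E.
    replace (phi w * (w - z) - phi z * (w - z))%C with ((phi w - phi z) * (w - z))%C by ring.
    rewrite Cmod_mult. apply Rmult_le_compat_r; [apply Cmod_ge_0|]. left; apply H', Hw.
Qed.

Lemma cderiv_ccont (f : C -> C) (z l : C) : cderiv f z l -> ccont f z.
Proof.
  intros D. apply cderiv_carath in D. destruct D as [phi [E [K H]]].
  apply (ccont_ext (fun w => f z + phi w * (w - z))%C).
  intros w. rewrite <- (H w). ring.
  apply ccont_plus; [apply ccont_const|]. apply ccont_mult; [exact K|].
  apply ccont_minus; [apply ccont_id|apply ccont_const].
Qed.

Lemma cderiv_ext_loc (f g : C -> C) (z l : C) (r : R) : 0 < r ->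
  (forall w, Cmod (w - z) < r -> f w = g w) -> cderiv f z l -> cderiv g z l.
Proof.
  intros Hr E F e He. destruct (F e He) as [d [Hd H]].
  exists (Rmin d r). split; [apply Rmin_pos; assumption|].
  intros w Hw. pose proof (Rmin_l d r). pose proof (Rmin_r d r).
  rewrite <- (E w), <- (E z). apply H. lra. rewrite Cmod_diag; lra. lra.
Qed.

Lemma cderiv_const (c z : C) : cderiv (fun _ => c) z (RtoC 0).
Proof.
  apply cderiv_carath. exists (fun _ => RtoC 0). split; [reflexivity|].
  split; [apply ccont_const|]. intros w. ring.
Qed.

Lemma cderiv_id (z : C) : cderiv (fun w => w) z (RtoC 1).
Proof.
  apply cderiv_carath. exists (fun _ => RtoC 1). split; [reflexivity|].
  split; [apply ccont_const|]. intros w. ring.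
Qed.

Lemma cderiv_plus (f g : C -> C) (z l m : C) :
  cderiv f z l -> cderiv g z m -> cderiv (fun w => f w + g w)%C z (l + m)%C.
Proof.
  intros F G. apply cderiv_carath in F. apply cderiv_carath in G. apply cderiv_carath.
  destruct F as [p [Ep [Kp Hp]]], G as [q [Eq [Kq Hq]]].
  exists (fun w => p w + q w)%C. rewrite Ep, Eq. split; [reflexivity|].
  split; [apply ccont_plus; assumption|]. intros w.
  replace (f w + g w - (f z + g z))%C with ((f w - f z) + (g w - g z))%C by ring.
  rewrite Hp, Hq. ring.
Qed.

Lemma cderiv_mult (f g : C -> C) (z l m : C) :
  cderiv f z l -> cderiv g z m ->
  cderiv (fun w => f w * g w)%C z (l * g z + f z * m)%C.
Proof.
  intros F G. pose proof (cderiv_ccont _ _ _ G) as Kg.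
  apply cderiv_carath in F. apply cderiv_carath in G. apply cderiv_carath.
  destruct F as [p [Ep [Kp Hp]]], G as [q [Eq [Kq Hq]]].
  exists (fun w => p w * g w + f z * q w)%C. rewrite Ep, Eq. split; [reflexivity|].
  split.
  - apply ccont_plus; apply ccont_mult; auto using ccont_const.
  - intros w.
    replace (f w * g w - (f z * g z))%C with ((f w - f z) * g w + f z * (g w - g z))%C by ring.
    rewrite Hp, Hq. ring.
Qed.

Lemma cderiv_minus (f g : C -> C) (z l m : C) :
  cderiv f z l -> cderiv g z m -> cderiv (fun w => f w - g w)%C z (l - m)%C.
Proof.
  intros F G. apply cderiv_carath in F. apply cderiv_carath in G. apply cderiv_carath.
  destruct F as [p [Ep [Kp Hp]]], G as [q [Eq [Kq Hq]]].
  exists (fun w => p w - q w)%C. rewrite Ep, Eq. split; [reflexivity|].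
  split; [apply ccont_minus; assumption|]. intros w.
  replace (f w - g w - (f z - g z))%C with ((f w - f z) - (g w - g z))%C by ring.
  rewrite Hp, Hq. ring.
Qed.

Lemma cderiv_comp (f g : C -> C) (z l m : C) :
  cderiv f z l -> cderiv g (f z) m -> cderiv (fun w => g (f w)) z (m * l)%C.
Proof.
  intros F G. pose proof (cderiv_ccont _ _ _ F) as Kf.
  apply cderiv_carath in F. apply cderiv_carath in G. apply cderiv_carath.
  destruct F as [p [Ep [Kp Hp]]], G as [q [Eq [Kq Hq]]].
  exists (fun w => q (f w) * p w)%C. rewrite Ep, Eq. split; [reflexivity|].
  split.
  - apply ccont_mult; [|exact Kp]. apply ccont_comp; assumption.
  - intros w. rewrite Hq, Hp. ring.
Qed.

Lemma cderiv_inv (f : C -> C) (z l : C) : cderiv f z l -> f z <> RtoC 0 ->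
  cderiv (fun w => / f w)%C z (- l / (f z * f z))%C.
Proof.
  intros F N. pose proof (cderiv_ccont _ _ _ F) as Kf.
  destruct (ccont_lower f z Kf N) as [d [Hd H]].
  apply cderiv_carath in F. destruct F as [p [Ep [Kp Hp]]].
  set (phi := fun w => (- p w / (f w * f z))%C).
  assert (Kphi : ccont phi z).
  { unfold phi. apply ccont_div.
    - apply (ccont_ext (fun w => (- RtoC 1) * p w)%C).
      intros w. ring. apply ccont_mult; auto using ccont_const.
    - apply ccont_mult; auto using ccont_const.
    - apply Cmult_neq_0; exact N. }
  (* The factorisation must hold for all [w], but [/ f w] satisfies it only where [f w <> 0]. Hence
     it is proved for the function built from the slope [phi], which agrees with [/ f w] near
     [z]. *)
  apply (cderiv_ext_loc (fun w => / f z + phi w * (w - z))%C _ _ _ d Hd).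
  - intros w Hw. specialize (H w Hw). apply Cmod_pos in N as P.
    assert (Nw : f w <> RtoC 0) by (apply Cmod_pos_neq; lra).
    unfold phi. replace (- p w / (f w * f z) * (w - z))%C with (- (p w * (w - z)) / (f w * f z))%C
      by (field; auto). rewrite <- Hp. field. auto.
  - apply cderiv_carath. exists phi. split.
    unfold phi. rewrite Ep. reflexivity. split; [exact Kphi|]. intros w. ring.
Qed.

Lemma cderiv_div (f g : C -> C) (z l m : C) : cderiv f z l -> cderiv g z m -> g z <> RtoC 0 ->
  exists k, cderiv (fun w => f w / g w)%C z k.
Proof.
  intros F G N. eexists. apply cderiv_mult; [exact F|apply cderiv_inv; [exact G|exact N]].
Qed.

Lemma cderiv_scale (f : C -> C) (z l c : C) : cderiv f z l -> cderiv (fun w => c * f w)%C z (c * l)%C.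
Proof.
  intros F. pose proof (cderiv_mult _ _ _ _ _ (cderiv_const c z) F) as H.
  replace (c * l)%C with (RtoC 0 * f z + c * l)%C by ring. exact H.
Qed.

Lemma is_derive_cderiv (f : C -> C) (z l : C) :
  @is_derive C_AbsRing C_NormedModule f z l -> cderiv f z l.
Proof.
  intros [_ H] e He.
  specialize (H z (fun P HP => HP) (mkposreal e He)). destruct H as [d H].
  exists d. split; [apply cond_pos|]. intros w Hw.
  specialize (H w Hw).
  change (Cmod (f w - f z - (w - z) * l) <= e * Cmod (w - z)) in H.
  rewrite Cmult_comm in H. exact H.
Qed.

Lemma cderiv_Re (F : C -> C) (s : R) (l : C) :
  cderiv F (RtoC s) l -> is_derive (fun t => Re (F (RtoC t))) s (Re l).
Proof.
  intros D. apply is_derive_Reals. intros e He.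
  destruct (D (e/2)) as [d [Hd H]]; [lra|].
  exists (mkposreal d Hd). intros k Nk Hk. simpl in Hk.
  specialize (H (RtoC (s + k))).
  replace (RtoC (s + k) - RtoC s)%C with (RtoC k) in H by (rewrite RtoC_plus; ring).
  rewrite Cmod_R in H. specialize (H Hk).
  apply Rle_lt_trans with (e / 2); [|lra].
  set (u := F (RtoC (s + k))) in *. set (v := F (RtoC s)) in *.
  replace ((Re u - Re v) / k - Re l) with (Re (u - v - l * RtoC k) / k)
    by (unfold Re; simpl; field; exact Nk).
  unfold Rdiv. rewrite Rabs_mult, Rabs_inv. apply Rle_div_l. apply Rabs_pos_lt, Nk.
  eapply Rle_trans; [apply re_le_Cmod|exact H].
Qed.

(** * Bisection and extrema on discs *)

Lemma Cmod_le_Re_Im (z : C) : Cmod z <= Rabs (Re z) + Rabs (Im z).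
Proof.
  apply Rsqr_incr_0_var; [|pose proof (Rabs_pos (Re z)); pose proof (Rabs_pos (Im z)); lra].
  rewrite !Rsqr_pow2, Cmod2_alt.
  pose proof (Rabs_pos (Re z)); pose proof (Rabs_pos (Im z)).
  rewrite <- (pow2_abs (Re z)), <- (pow2_abs (Im z)). nra.
Qed.

Lemma nested_dyadic (a : R) (u : nat -> R) : 0 < a ->
  (forall n, u n <= u (S n) /\ u (S n) + a * (/ 2) ^ (S n) <= u n + a * (/ 2) ^ n) ->
  exists L, forall n, u n <= L <= u n + a * (/ 2) ^ n.
Proof.
  intros Ha H.
  assert (Hp : forall n, 0 < a * (/ 2) ^ n) by (intros n; apply Rmult_lt_0_compat; [|apply pow_lt]; lra).
  assert (G1 : forall n k, u n <= u (n + k)%nat).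
  { intros n k. induction k as [|k IH]. rewrite Nat.add_0_r; lra.
    rewrite Nat.add_succ_r. destruct (H (n + k)%nat). lra. }
  assert (G2 : forall n k, u (n + k)%nat + a * (/ 2) ^ (n + k) <= u n + a * (/ 2) ^ n).
  { intros n k. induction k as [|k IH]. rewrite Nat.add_0_r; lra.
    rewrite Nat.add_succ_r. destruct (H (n + k)%nat). lra. }
  assert (G : forall m n, u m <= u n + a * (/ 2) ^ n).
  { intros m n. pose proof (G1 m n). pose proof (G2 n m). rewrite Nat.add_comm in H1.
    pose proof (Hp (m + n)%nat). lra. }
  destruct (completeness (fun x => exists n, x = u n)) as [L [L1 L2]].
  - exists (u 0%nat + a * (/ 2) ^ 0). intros x [n ->]. apply G.
  - exists (u 0%nat), 0%nat. reflexivity.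
  - exists L. intros n. split.
    + apply L1. exists n; reflexivity.
    + apply L2. intros x [m ->]. apply G.
Qed.

(* [P x y d] concerns the box [x, x + a d] x [y, y + b d].  If it failed, bisection would produce bad
   boxes shrinking to a point. *)
Lemma bisection_induction (X Y a b : R) (P : R -> R -> R -> Prop) : 0 < a -> 0 < b ->
  (forall x y d, 0 < d -> X <= x -> x + a * d <= X + a -> Y <= y -> y + b * d <= Y + b ->
     P x y (d / 2) -> P (x + a * (d / 2)) y (d / 2) ->
     P x (y + b * (d / 2)) (d / 2) -> P (x + a * (d / 2)) (y + b * (d / 2)) (d / 2) ->
     P x y d) ->
  (forall x0 y0, X <= x0 <= X + a -> Y <= y0 <= Y + b ->
     exists e, 0 < e /\ forall x y d, 0 < d < e ->
       X <= x -> x + a * d <= X + a -> Y <= y -> y + b * d <= Y + b ->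
       x <= x0 <= x + a * d -> y <= y0 <= y + b * d -> P x y d) ->
  P X Y 1.
Proof.
  intros Ha Hb Hs Hl. apply NNPP. intros HN.
  set (bad := fun d s => 0 < d /\ X <= fst s /\ fst s + a * d <= X + a /\ Y <= snd s /\
                snd s + b * d <= Y + b /\ ~ P (fst s) (snd s) d).
  (* The implication stands under the existential so that choice yields a total function [next], and
     the boxes form a plain recursive sequence. *)
  assert (Step : forall d s, exists s', bad d s ->
     bad (d / 2) s' /\ (fst s <= fst s' /\ fst s' + a * (d / 2) <= fst s + a * d) /\
     (snd s <= snd s' /\ snd s' + b * (d / 2) <= snd s + b * d)).
  { intros d [x y]. destruct (classic (bad d (x, y))) as [B|B]; [|exists (x, y); tauto].
    destruct B as [Hd [B1 [B2 [B3 [B4 B5]]]]]. simpl in *.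
    assert (Hda : 0 < a * (d / 2)) by nra. assert (Hdb : 0 < b * (d / 2)) by nra.
    assert (Ea : a * d = a * (d / 2) + a * (d / 2)) by field.
    assert (Eb : b * d = b * (d / 2) + b * (d / 2)) by field.
    destruct (classic (P x y (d / 2))) as [P1|P1];
      [|exists (x, y); intros _; unfold bad; simpl; repeat split; try lra; exact P1].
    destruct (classic (P (x + a * (d / 2)) y (d / 2))) as [P2|P2];
      [|exists (x + a * (d / 2), y); intros _; unfold bad; simpl; repeat split; try lra; exact P2].
    destruct (classic (P x (y + b * (d / 2)) (d / 2))) as [P3|P3];
      [|exists (x, y + b * (d / 2)); intros _; unfold bad; simpl; repeat split; try lra; exact P3].
    destruct (classic (P (x + a * (d / 2)) (y + b * (d / 2)) (d / 2))) as [P4|P4];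
      [|exists (x + a * (d / 2), y + b * (d / 2)); intros _; unfold bad; simpl; repeat split; try lra; exact P4].
    exfalso. apply B5, Hs; assumption. }
  set (next := fun d s => proj1_sig (constructive_indefinite_description _ (Step d s))).
  assert (Hnext : forall d s, bad d s ->
     bad (d / 2) (next d s) /\ (fst s <= fst (next d s) /\ fst (next d s) + a * (d / 2) <= fst s + a * d) /\
     (snd s <= snd (next d s) /\ snd (next d s) + b * (d / 2) <= snd s + b * d)).
  { intros d s. unfold next.
    destruct (constructive_indefinite_description _ (Step d s)) as [s' Hs']. exact Hs'. }
  set (seq := fix seq n := match n with O => (X, Y) | S m => next ((/ 2) ^ m) (seq m) end).
  assert (Bad : forall n, bad ((/ 2) ^ n) (seq n)).
  { induction n as [|n IH].
    - unfold bad; simpl. repeat split; try lra. exact HN.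
    - destruct (Hnext _ _ IH) as [B _]. simpl.
      replace (/ 2 * (/ 2) ^ n) with ((/ 2) ^ n / 2) by field. exact B. }
  assert (E2 : forall n, (/ 2) ^ S n = (/ 2) ^ n / 2) by (intros n; simpl; field).
  destruct (nested_dyadic a (fun n => fst (seq n)) Ha) as [x0 Hx].
  { intros n. rewrite E2. apply (Hnext _ _ (Bad n)). }
  destruct (nested_dyadic b (fun n => snd (seq n)) Hb) as [y0 Hy].
  { intros n. rewrite E2. apply (Hnext _ _ (Bad n)). }
  destruct (Hl x0 y0) as [e [He H]].
  { specialize (Hx 0%nat). simpl in Hx. lra. }
  { specialize (Hy 0%nat). simpl in Hy. lra. }
  destruct (pow_lt_1_zero (/ 2)) with (y := e) as [N HN'].
  { rewrite Rabs_pos_eq; lra. }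
  { exact He. }
  specialize (HN' N (Nat.le_refl N)).
  rewrite Rabs_pos_eq in HN' by (apply pow_le; lra).
  destruct (Bad N) as [B0 [B1 [B2 [B3 [B4 B5]]]]]. apply B5, H; auto.
Qed.

(** Without a maximum, every point of the disc is beaten by another. The property that a single
    point of the disc beats all points of the disc lying in a given box passes from the quarters to
    the box and holds for small boxes, hence for a box containing the disc. That single point then
    beats itself. *)
Lemma disc_max (c : C) (r : R) (Phi : C -> R) : 0 <= r ->
  (forall z, Cmod (z - c) <= r -> ccont (fun w => RtoC (Phi w)) z) ->
  exists z0, Cmod (z0 - c) <= r /\ forall z, Cmod (z - c) <= r -> Phi z <= Phi z0.
Proof.
  intros Hr HK. apply NNPP. intros HN.
  assert (Hup : forall z, Cmod (z - c) <= r -> exists w, Cmod (w - c) <= r /\ Phi z < Phi w).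
  { intros z Hz. apply NNPP. intros N. apply HN. exists z. split; [exact Hz|].
    intros w Hw. apply Rnot_lt_le. intros L. apply N. exists w. auto. }
  set (R0 := r + 1). assert (HR0 : 0 < R0) by (unfold R0; lra).
  assert (Q : exists w, Cmod (w - c) <= r /\ forall z : C, Cmod (z - c) <= r ->
    Re c - R0 <= Re z <= Re c - R0 + 2 * R0 * 1 -> Im c - R0 <= Im z <= Im c - R0 + 2 * R0 * 1 ->
    Phi z < Phi w).
  { apply (bisection_induction (Re c - R0) (Im c - R0) (2 * R0) (2 * R0)
      (fun x y d => exists w, Cmod (w - c) <= r /\ forall z : C, Cmod (z - c) <= r ->
        x <= Re z <= x + 2 * R0 * d -> y <= Im z <= y + 2 * R0 * d -> Phi z < Phi w)); try lra.
    - intros x y d Hd _ _ _ _ [w1 [W1 H1]] [w2 [W2 H2]] [w3 [W3 H3]] [w4 [W4 H4]].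
      assert (M : forall u v, Cmod (u - c) <= r -> Cmod (v - c) <= r ->
        exists w, Cmod (w - c) <= r /\ Phi u <= Phi w /\ Phi v <= Phi w).
      { intros u v Hu Hv. destruct (Rle_dec (Phi u) (Phi v)).
        exists v; repeat split; auto; lra. exists u; repeat split; auto; lra. }
      destruct (M w1 w2 W1 W2) as [w5 [W5 [L1 L2]]].
      destruct (M w3 w4 W3 W4) as [w6 [W6 [L3 L4]]].
      destruct (M w5 w6 W5 W6) as [w [W [L5 L6]]].
      exists w. split; [exact W|]. intros z Hz Hx Hy.
      destruct (Rle_dec (Re z) (x + 2 * R0 * (d / 2))) as [Cx|Cx];
      destruct (Rle_dec (Im z) (y + 2 * R0 * (d / 2))) as [Cy|Cy].
      + specialize (H1 z Hz). lra.
      + specialize (H3 z Hz). lra.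
      + specialize (H2 z Hz). lra.
      + specialize (H4 z Hz). lra.
    - intros x0 y0 _ _. set (p := (x0, y0) : C).
      assert (Q : exists e w, 0 < e /\ Cmod (w - c) <= r /\
        forall z, Cmod (z - c) <= r -> Cmod (z - p) < e -> Phi z < Phi w).
      { destruct (Rle_dec (Cmod (p - c)) r) as [Hp|Hp].
        - destruct (Hup p Hp) as [w [Hw L]].
          destruct (HK p Hp (Phi w - Phi p)) as [e [He H]]; [lra|].
          exists e, w. split; [exact He|]. split; [exact Hw|]. intros z _ Hz.
          specialize (H z Hz). rewrite <- RtoC_minus, Cmod_R in H. apply Rabs_def2 in H. lra.
        (* Near a point outside the disc there is nothing to beat, and the centre serves as a dummy
           witness. *)
        - exists (Cmod (p - c) - r), c. split; [lra|]. split; [rewrite Cmod_diag; lra|].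
          intros z H1 H2. pose proof (Cmod_triangle_via p z c). rewrite Cmod_sub_sym in H2. lra. }
      destruct Q as [e [w [He [Hw H]]]].
      exists (e / (4 * R0 + 1)). split. apply Rdiv_lt_0_compat; lra.
      intros x y d [Hd1 Hd2] _ _ _ _ Hx Hy. exists w. split; [exact Hw|].
      intros z Hz Zx Zy. apply H; [exact Hz|].
      eapply Rle_lt_trans; [apply Cmod_le_Re_Im|].
      assert (Rabs (Re (z - p)) <= 2 * R0 * d).
      { unfold Re, p, Cminus, Cplus, Copp in *; simpl in *. apply Rabs_le. lra. }
      assert (Rabs (Im (z - p)) <= 2 * R0 * d).
      { unfold Im, p, Cminus, Cplus, Copp in *; simpl in *. apply Rabs_le. lra. }
      apply Rlt_div_r in Hd2; [|lra]. nra. }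
  destruct Q as [w [Hw H]]. apply (Rlt_irrefl (Phi w)). apply H; [exact Hw| |].
  - pose proof (re_le_Cmod (w - c)) as T. unfold Re, Cminus, Cplus, Copp in *; simpl in *.
    apply Rabs_le_between in T. unfold R0. lra.
  - assert (T : Rabs (Im (w - c)) <= Cmod (w - c)) by
      (eapply Rle_trans; [apply Rmax_r|apply Rmax_Cmod]).
    unfold Im, Cminus, Cplus, Copp in *; simpl in *.
    apply Rabs_le_between in T. unfold R0. lra.
Qed.

(** * Goursat's lemma and the mean value property *)

(** Differentiability at one point with gradient [(A, B)], measured in the l1 norm. It asserts
    nothing about neighbouring points, which is the setting of Goursat's argument. *)
Definition diff2 (u : R -> R -> R) (x0 y0 A B : R) : Prop :=
  forall e, 0 < e -> exists d, 0 < d /\ forall x y, Rabs (x - x0) < d -> Rabs (y - y0) < d ->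
    Rabs (u x y - u x0 y0 - A * (x - x0) - B * (y - y0)) <= e * (Rabs (x - x0) + Rabs (y - y0)).

Lemma diff2_swap (u : R -> R -> R) (x0 y0 A B : R) :
  diff2 u x0 y0 A B -> diff2 (fun y x => u x y) y0 x0 B A.
Proof.
  intros D e He. destruct (D e He) as [d [Hd H]]. exists d. split; [exact Hd|].
  intros y x Hy Hx. specialize (H x y Hx Hy).
  replace (u x y - u x0 y0 - B * (y - y0) - A * (x - x0))
    with (u x y - u x0 y0 - A * (x - x0) - B * (y - y0)) by ring. lra.
Qed.

Lemma diff2_continuous (u : R -> R -> R) (x0 y0 A B : R) :
  diff2 u x0 y0 A B -> continuous (fun y => u x0 y) y0.
Proof.
  intros D. apply (ex_derive_continuous (V := R_NormedModule)). exists B. apply is_derive_Reals. intros e He.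
  destruct (D (e/2)) as [d [Hd H]]; [lra|]. exists (mkposreal d Hd).
  intros k Nk Hk. simpl in Hk. specialize (H x0 (y0 + k)).
  replace (x0 - x0) with 0 in H by ring. replace (y0 + k - y0) with k in H by ring.
  rewrite Rabs_R0 in H. specialize (H Hd Hk).
  apply Rle_lt_trans with (e / 2); [|lra].
  replace ((u x0 (y0 + k) - u x0 y0) / k - B) with ((u x0 (y0 + k) - u x0 y0 - A * 0 - B * k) / k)
    by (field; exact Nk).
  unfold Rdiv. rewrite Rabs_mult, Rabs_inv. apply Rle_div_l. apply Rabs_pos_lt, Nk. lra.
Qed.

(** Meant for two opposite sides of a small box: [K] is the difference of the integrands predicted
    by the linear approximation, [M] the error. *)
Lemma RInt_sub_bound (f g : R -> R) (a b K M : R) : a <= b ->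
  ex_RInt f a b -> ex_RInt g a b ->
  (forall t, a <= t <= b -> Rabs (f t - g t - K) <= M) ->
  Rabs (RInt f a b - RInt g a b - K * (b - a)) <= M * (b - a).
Proof.
  intros Hab Ef Eg H.
  pose proof (ex_RInt_const a b K) as Ek.
  pose proof (ex_RInt_minus f g a b Ef Eg) as E1.
  pose proof (ex_RInt_minus _ _ a b E1 Ek) as E2.
  assert (Q : RInt (fun t => minus (minus (f t) (g t)) K) a b
    = RInt f a b - RInt g a b - K * (b - a)).
  { rewrite (RInt_minus (fun t => minus (f t) (g t)) (fun _ => K)) by assumption.
    rewrite (RInt_minus f g) by assumption. rewrite RInt_const.
    unfold minus, plus, opp, scal; simpl; unfold mult; simpl. ring. }
  rewrite <- Q, Rmult_comm. apply abs_RInt_le_const; assumption.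
Qed.

(** The hypothesis says that [u_x = v_y = A], and the claim is the equality of the two double
    integrals of [A]. The defect [J] is additive under subdivision. On a box of scale [d] close to a
    point, the linear parts contribute [A * (a d) * (b d)] to both sides and cancel, which leaves
    less than [e * d^2]; bisection carries this estimate to the whole box. *)
Lemma goursat (u v : R -> R -> R) (X Y a b : R) : 0 < a -> 0 < b ->
  (forall x y, X <= x <= X + a -> Y <= y <= Y + b ->
     exists A B D, diff2 u x y A B /\ diff2 v x y D A) ->
  RInt (u (X + a)) Y (Y + b) - RInt (u X) Y (Y + b) =
  RInt (fun x => v x (Y + b)) X (X + a) - RInt (fun x => v x Y) X (X + a).
Proof.
  intros Ha Hb H.
  assert (Eu : forall x y1 y2, X <= x <= X + a -> Y <= y1 <= y2 -> y2 <= Y + b -> ex_RInt (u x) y1 y2).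
  { intros x y1 y2 Hx Hy1 Hy2. apply (ex_RInt_continuous (V := R_CompleteNormedModule)). intros y Hy.
    rewrite Rmin_left, Rmax_right in Hy by lra.
    destruct (H x y Hx) as [A [B [D [Du _]]]]; [lra|]. exact (diff2_continuous _ _ _ _ _ Du). }
  assert (Ev : forall y x1 x2, Y <= y <= Y + b -> X <= x1 <= x2 -> x2 <= X + a ->
    ex_RInt (fun x => v x y) x1 x2).
  { intros y x1 x2 Hy Hx1 Hx2. apply (ex_RInt_continuous (V := R_CompleteNormedModule)). intros x Hx.
    rewrite Rmin_left, Rmax_right in Hx by lra.
    destruct (H x y) as [A [B [D [_ Dv]]]]; [lra|exact Hy|].
    exact (diff2_continuous _ _ _ _ _ (diff2_swap _ _ _ _ _ Dv)). }
  set (J := fun x1 x2 y1 y2 => RInt (u x2) y1 y2 - RInt (u x1) y1 y2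
     - (RInt (fun x => v x y2) x1 x2 - RInt (fun x => v x y1) x1 x2)).
  assert (HJ : forall e, 0 < e -> Rabs (J X (X + a * 1) Y (Y + b * 1)) <= e * (1 * 1)).
  { intros e He.
    apply (bisection_induction X Y a b
      (fun x y d => Rabs (J x (x + a * d) y (y + b * d)) <= e * (d * d)) Ha Hb).
    - intros x y d Hd X1 X2 Y1 Y2 H1 H2 H3 H4.
      assert (Da : 0 < a * (d / 2)) by nra. assert (Db : 0 < b * (d / 2)) by nra.
      replace (x + a * d) with (x + a * (d / 2) + a * (d / 2)) in * by field.
      replace (y + b * d) with (y + b * (d / 2) + b * (d / 2)) in * by field.
      set (x2 := x + a * (d / 2)) in *. set (x3 := x2 + a * (d / 2)) in *.
      set (y2 := y + b * (d / 2)) in *. set (y3 := y2 + b * (d / 2)) in *.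
      assert (x < x2 < x3) by (unfold x3, x2; lra). assert (y < y2 < y3) by (unfold y3, y2; lra).
      assert (CV : forall t, X <= t <= X + a -> RInt (u t) y y3 = RInt (u t) y y2 + RInt (u t) y2 y3).
      { intros t Ht. symmetry. apply (RInt_Chasles (u t)); apply Eu; lra. }
      assert (CH : forall t, Y <= t <= Y + b -> RInt (fun s => v s t) x x3
        = RInt (fun s => v s t) x x2 + RInt (fun s => v s t) x2 x3).
      { intros t Ht. symmetry. apply (RInt_Chasles (fun s => v s t)); apply Ev; lra. }
      replace (J x x3 y y3) with (J x x2 y y2 + J x2 x3 y y2 + J x x2 y2 y3 + J x2 x3 y2 y3)
        by (unfold J; rewrite (CV x), (CV x3), (CH y), (CH y3) by lra; ring).
      replace (e * (d * d)) with (e * (d/2 * (d/2)) + e * (d/2 * (d/2)) + e * (d/2 * (d/2)) + e * (d/2 * (d/2))) by field.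
      apply Rabs_le_between in H1, H2, H3, H4. apply Rabs_le. lra.
    - intros x0 y0 Hx0 Hy0. destruct (H x0 y0 Hx0 Hy0) as [A [B [D [Du Dv]]]].
      (* Each integrand on a side is within [L = k (a + b) d] of its linear approximation, so the
         four sides give [2 L (a + b) d], which this choice makes equal to [e d^2]. *)
      set (k := e / (2 * (a + b) * (a + b))).
      assert (Hab : 0 < 2 * (a + b) * (a + b)) by nra.
      assert (Hk : 0 < k) by (apply Rdiv_lt_0_compat; assumption).
      destruct (Du k Hk) as [d1 [Hd1 H1]]. destruct (Dv k Hk) as [d2 [Hd2 H2]].
      set (m := Rmin d1 d2). assert (Hm : 0 < m) by (apply Rmin_pos; assumption).
      assert (M1 : m <= d1) by apply Rmin_l. assert (M2 : m <= d2) by apply Rmin_r.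
      exists (m / (a + b)). split. apply Rdiv_lt_0_compat; lra.
      intros x y d [Hd Hd'] X1 X2 Y1 Y2 Hx Hy.
      apply Rlt_div_r in Hd'; [|lra].
      assert (Da : 0 < a * d) by nra. assert (Db : 0 < b * d) by nra.
      set (L := k * ((a + b) * d)).
      assert (Bd : forall s t, x <= s <= x + a * d -> y <= t <= y + b * d ->
        Rabs (u s t - u x0 y0 - A * (s - x0) - B * (t - y0)) <= L /\
        Rabs (v s t - v x0 y0 - D * (s - x0) - A * (t - y0)) <= L).
      { intros s t Hs Ht.
        assert (H3 : Rabs (s - x0) <= a * d) by (apply Rabs_le; lra).
        assert (Rabs (t - y0) <= b * d) by (apply Rabs_le; lra).
        assert (H4 : k * (Rabs (s - x0) + Rabs (t - y0)) <= L)
          by (apply Rmult_le_compat_l; lra).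
        split; (eapply Rle_trans; [|exact H4]); [apply H1|apply H2]; lra. }
      assert (I1 : Rabs (RInt (u (x + a * d)) y (y + b * d) - RInt (u x) y (y + b * d)
         - A * (a * d) * (y + b * d - y)) <= 2 * L * (y + b * d - y)).
      { apply RInt_sub_bound; [lra| | |]. apply Eu; lra. apply Eu; lra.
        intros t Ht. destruct (Bd (x + a * d) t) as [T1 _]; [lra|lra|].
        destruct (Bd x t) as [T2 _]; [lra|lra|].
        apply Rabs_le_between in T1, T2. apply Rabs_le. lra. }
      assert (I2 : Rabs (RInt (fun s => v s (y + b * d)) x (x + a * d) - RInt (fun s => v s y) x (x + a * d)
         - A * (b * d) * (x + a * d - x)) <= 2 * L * (x + a * d - x)).
      { apply (RInt_sub_bound (fun s => v s (y + b * d)) (fun s => v s y)); [lra| | |].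
        apply Ev; lra. apply Ev; lra.
        intros t Ht. destruct (Bd t (y + b * d)) as [_ T1]; [lra|lra|].
        destruct (Bd t y) as [_ T2]; [lra|lra|].
        apply Rabs_le_between in T1, T2. apply Rabs_le. lra. }
      unfold J.
      replace (e * (d * d)) with (2 * L * (b * d) + 2 * L * (a * d)) by (unfold L, k; field; lra).
      apply Rabs_le_between in I1, I2. apply Rabs_le. lra. }
  rewrite !Rmult_1_r in HJ.
  assert (J0 : J X (X + a) Y (Y + b) = 0).
  { destruct (Req_dec (J X (X + a) Y (Y + b)) 0) as [E|N]; [exact E|].
    apply Rabs_pos_lt in N. specialize (HJ (Rabs (J X (X + a) Y (Y + b)) / 2)). lra. }
  unfold J in J0. lra.
Qed.

(** * Complex exponential and circular means *)

Definition Cexp (s : C) : C := (exp (Re s) * cos (Im s), exp (Re s) * sin (Im s)).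

Lemma Cexp_plus (s t : C) : Cexp (s + t) = (Cexp s * Cexp t)%C.
Proof.
  unfold Cexp, Cmult, Cplus, Re, Im; simpl. rewrite exp_plus, cos_plus, sin_plus.
  f_equal; ring.
Qed.

Lemma Cmod_Cexp (s : C) : Cmod (Cexp s) = exp (Re s).
Proof.
  unfold Cmod, Cexp; simpl.
  replace (exp (Re s) * cos (Im s) * (exp (Re s) * cos (Im s) * 1) +
    exp (Re s) * sin (Im s) * (exp (Re s) * sin (Im s) * 1))
    with (Rsqr (exp (Re s)) * (Rsqr (sin (Im s)) + Rsqr (cos (Im s)))) by (unfold Rsqr; ring).
  rewrite sin2_cos2, Rmult_1_r. apply sqrt_Rsqr. left; apply exp_pos.
Qed.

Lemma derivable_pt_lim_0_bound (f : R -> R) (l : R) : derivable_pt_lim f 0 l ->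
  forall e, 0 < e -> exists d, 0 < d /\ forall x, Rabs x < d -> Rabs (f x - f 0 - l * x) <= e * Rabs x.
Proof.
  intros D e He. destruct (D e He) as [d H]. exists d. split; [apply cond_pos|].
  intros x Hx. destruct (Req_dec x 0) as [->|N].
  - replace (f 0 - f 0 - l * 0) with 0 by ring. rewrite Rabs_R0. lra.
  - specialize (H x N Hx). rewrite Rplus_0_l in H.
    replace (f x - f 0 - l * x) with (((f x - f 0) / x - l) * x) by (field; exact N).
    rewrite Rabs_mult. apply Rmult_le_compat_r; [apply Rabs_pos|lra].
Qed.

Lemma cderiv_Cexp (s : C) : cderiv Cexp s (Cexp s).
Proof.
  (* The derivative at 0; the functional equation transports it to [s]. *)
  assert (Z : forall e, 0 < e -> exists d, 0 < d /\ forall w, Cmod w < d ->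
    Cmod (Cexp w - RtoC 1 - w) <= e * Cmod w).
  (* With [m = Cmod (x, y)], the real part of the error is at most [3 k m] and the imaginary part at
     most [5 k m], so [e / 12] suffices. *)
  { intros e He. set (k := Rmin 1 (e / 12)).
    assert (Hk : 0 < k) by (apply Rmin_pos; lra).
    assert (K1 : k <= 1) by apply Rmin_l. assert (K2 : k <= e / 12) by apply Rmin_r.
    destruct (derivable_pt_lim_0_bound _ _ (derivable_pt_lim_exp 0) k Hk) as [d1 [Hd1 E1]].
    destruct (derivable_pt_lim_0_bound _ _ (derivable_pt_lim_cos 0) k Hk) as [d2 [Hd2 E2]].
    destruct (derivable_pt_lim_0_bound _ _ (derivable_pt_lim_sin 0) k Hk) as [d3 [Hd3 E3]].
    exists (Rmin k (Rmin d1 (Rmin d2 d3))). split. do 3 (apply Rmin_pos; [assumption|]); assumption.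
    intros [x y] Hw.
    pose proof (Rmin_l k (Rmin d1 (Rmin d2 d3))). pose proof (Rmin_r k (Rmin d1 (Rmin d2 d3))).
    pose proof (Rmin_l d1 (Rmin d2 d3)). pose proof (Rmin_r d1 (Rmin d2 d3)).
    pose proof (Rmin_l d2 d3). pose proof (Rmin_r d2 d3).
    pose proof (Rmax_Cmod (x, y)) as Mx. simpl in Mx.
    pose proof (Rmax_l (Rabs x) (Rabs y)). pose proof (Rmax_r (Rabs x) (Rabs y)).
    set (m := Cmod (x, y)) in *.
    specialize (E1 x ltac:(lra)). specialize (E2 y ltac:(lra)). specialize (E3 y ltac:(lra)).
    rewrite exp_0 in E1. rewrite cos_0, sin_0 in E2. rewrite sin_0, cos_0 in E3.
    assert (B1 : k * Rabs x <= k * m) by nra. assert (B2 : k * Rabs y <= k * m) by nra.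
    eapply Rle_trans; [apply Cmod_le_Re_Im|].
    unfold Cexp, Re, Im, Cminus, Cplus, Copp; simpl.
    replace (exp x * cos y + - (1) + - x) with
      ((exp x - 1 - 1 * x) * cos y + (1 + x) * (cos y - 1 - - 0 * y)) by ring.
    replace (exp x * sin y + - 0 + - y) with
      ((exp x - 1 - 1 * x + x) * (sin y - 0 - 1 * y + y) + (sin y - 0 - 1 * y)) by ring.
    set (p := exp x - 1 - 1 * x) in *. set (q := cos y - 1 - - 0 * y) in *.
    set (t := sin y - 0 - 1 * y) in *.
    assert (Rabs (cos y) <= 1) by (pose proof (COS_bound y); apply Rabs_le; lra).
    assert (Rabs (1 + x) <= 2) by (pose proof (Rabs_triang 1 x); rewrite Rabs_R1 in *; lra).
    pose proof (Rabs_triang (p * cos y) ((1 + x) * q)) as T1.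
    pose proof (Rabs_triang ((p + x) * (t + y)) t) as T2.
    rewrite !Rabs_mult in *.
    pose proof (Rabs_triang p x). pose proof (Rabs_triang t y).
    assert (0 <= m) by apply Cmod_ge_0.
    pose proof (Rabs_pos p). pose proof (Rabs_pos q). pose proof (Rabs_pos t).
    pose proof (Rabs_pos x). pose proof (Rabs_pos y).
    assert (Rabs p * Rabs (cos y) <= k * m) by (pose proof (Rabs_pos (cos y)); nra).
    assert (Rabs (1 + x) * Rabs q <= 2 * (k * m)).
    { apply Rmult_le_compat; try apply Rabs_pos; lra. }
    assert (Rabs (p + x) <= 2 * k) by nra.
    assert (Rabs (t + y) <= 2 * m) by nra.
    assert (Rabs (p + x) * Rabs (t + y) <= 2 * k * (2 * m)).
    { apply Rmult_le_compat; try apply Rabs_pos; lra. }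
    assert (12 * (k * m) <= e * m) by nra.
    nra. }
  intros e He.
  assert (P : 0 < Cmod (Cexp s)) by (rewrite Cmod_Cexp; apply exp_pos).
  destruct (Z (e / Cmod (Cexp s))) as [d [Hd H]]. apply Rdiv_lt_0_compat; assumption.
  exists d. split; [exact Hd|]. intros w Hw. specialize (H (w - s)%C Hw).
  replace (Cexp w - Cexp s - Cexp s * (w - s))%C
    with (Cexp s * (Cexp (w - s) - RtoC 1 - (w - s)))%C.
  - rewrite Cmod_mult.
    replace (e * Cmod (w - s)) with (Cmod (Cexp s) * (e / Cmod (Cexp s) * Cmod (w - s))) by (field; lra).
    apply Rmult_le_compat_l; lra.
  - replace (Cexp w) with (Cexp s * Cexp (w - s))%C by (rewrite <- Cexp_plus; f_equal; ring). ring.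
Qed.

(** The Cauchy-Riemann equations: multiplication by [l] has the rows [(Re l, - Im l)] and
    [(Im l, Re l)], the shape that [goursat] asks for. *)
Lemma cderiv_diff2 (F : C -> C) (x y : R) (l : C) : cderiv F (x, y) l ->
  diff2 (fun s t => Re (F (s, t))) x y (Re l) (- Im l) /\
  diff2 (fun s t => Im (F (s, t))) x y (Im l) (Re l).
Proof.
  intros D.
  assert (Q : forall e, 0 < e -> exists d, 0 < d /\ forall s t, Rabs (s - x) < d -> Rabs (t - y) < d ->
    Cmod (F (s, t) - F (x, y) - l * ((s, t) - (x, y))) <= e * (Rabs (s - x) + Rabs (t - y))).
  { intros e He. destruct (D e He) as [d [Hd H]]. exists (d / 2). split; [lra|].
    intros s t Hs Ht. pose proof (Cmod_le_Re_Im ((s, t) - (x, y))%C) as M.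
    change (Re ((s, t) - (x, y))%C) with (s - x) in M.
    change (Im ((s, t) - (x, y))%C) with (t - y) in M.
    eapply Rle_trans; [apply H; lra|]. apply Rmult_le_compat_l; lra. }
  split; intros e He; destruct (Q e He) as [d [Hd H]]; exists d; (split; [exact Hd|]);
    intros s t Hs Ht; (eapply Rle_trans; [|apply (H s t Hs Ht)]).
  - eapply Rle_trans; [|apply re_le_Cmod]. right. f_equal. unfold Re, Im; simpl. ring.
  - eapply Rle_trans; [|apply Rmax_Cmod]. eapply Rle_trans; [|apply Rmax_r].
    right. f_equal. unfold Re, Im; simpl. ring.
Qed.

(* With [z = c + Cexp (x, y)], Goursat's lemma on the box [X, x] x [0, 2 PI] shows that the mean of
   [Re f] over the circle of radius [exp x] does not depend on [x]: the two horizontal sides cancel by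
   periodicity.  Continuity at [c] then gives the value; differentiability at [c] plays no role. *)
Lemma mean_value (f : C -> C) (c : C) (r x : R) : 0 < r ->
  ccont f c -> (forall z, 0 < Cmod (z - c) < r -> exists l, cderiv f z l) ->
  exp x < r ->
  ex_RInt (fun y => Re (f (c + Cexp (x, y))%C)) 0 (2 * PI) /\
  RInt (fun y => Re (f (c + Cexp (x, y))%C)) 0 (2 * PI) = 2 * PI * Re (f c).
Proof.
  intros Hr K D Hx. pose proof PI_RGT_0 as HPI.
  set (F := fun s => f (c + Cexp s)%C).
  assert (DF : forall s t, exp s < r -> exists l, cderiv F (s, t) l).
  { intros s t Hs. destruct (D (c + Cexp (s, t))%C) as [l Hl].
    - replace (c + Cexp (s, t) - c)%C with (Cexp (s, t)) by ring. rewrite Cmod_Cexp. simpl.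
      split; [apply exp_pos|exact Hs].
    - eexists. unfold F. apply cderiv_comp; [|exact Hl].
      apply cderiv_plus; [apply cderiv_const|apply cderiv_Cexp]. }
  assert (EF : forall s, exp s < r -> ex_RInt (fun y => Re (F (s, y))) 0 (2 * PI)).
  { intros s Hs. apply (ex_RInt_continuous (V := R_CompleteNormedModule)). intros y _.
    destruct (DF s y Hs) as [l Hl]. apply cderiv_diff2 in Hl. destruct Hl as [Hl _].
    exact (diff2_continuous _ _ _ _ _ Hl). }
  split; [exact (EF x Hx)|].
  change (RInt (fun y => Re (F (x, y))) 0 (2 * PI) = 2 * PI * Re (f c)).
  assert (CS : forall s, s < x -> RInt (fun y => Re (F (s, y))) 0 (2 * PI) = RInt (fun y => Re (F (x, y))) 0 (2 * PI)).
  { intros s Hs.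
    pose proof (goursat (fun s t => Re (F (s, t))) (fun s t => Im (F (s, t))) s 0 (x - s) (2 * PI)) as G.
    replace (s + (x - s)) with x in G by ring. rewrite Rplus_0_l in G.
    assert (P : forall t, F (t, 2 * PI) = F (t, 0)).
    { intros t. unfold F, Cexp; simpl. rewrite cos_2PI, sin_2PI, cos_0, sin_0. reflexivity. }
    rewrite (RInt_ext (fun t => Im (F (t, 2 * PI))) (fun t => Im (F (t, 0)))) in G
      by (intros t _; rewrite P; reflexivity).
    assert (forall p q : R, p - q = 0 -> q = p) as E by (intros; lra). apply E.
    etransitivity; [apply G; [lra|lra|]|ring].
    intros p q Hp _. destruct (DF p q) as [l Hl].
    { destruct (Rle_lt_or_eq_dec p x) as [L| ->]; [lra| |exact Hx].
      apply exp_increasing in L. lra. }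
    apply cderiv_diff2 in Hl. exists (Re l), (- Im l), (Im l). exact Hl. }
  set (I := RInt (fun y => Re (F (x, y))) 0 (2 * PI) : R) in *.
  assert (B : forall e, 0 < e -> Rabs (I - 2 * PI * Re (f c)) <= e * (2 * PI)).
  { intros e He. destruct (K e He) as [d [Hd H]].
    (* The circle of radius [exp s] is smaller than the given one and lies where [f] is [e]-close to
       [f c]. *)
    set (s := Rmin (x - 1) (ln d - 1)).
    assert (S1 : s < x) by (pose proof (Rmin_l (x - 1) (ln d - 1)); unfold s; lra).
    assert (S2 : exp s < d).
    { rewrite <- (exp_ln d Hd) at 1. apply exp_increasing. pose proof (Rmin_r (x - 1) (ln d - 1)); unfold s; lra. }
    rewrite <- (CS s S1).
    assert (exp s < r) by (apply exp_increasing in S1; lra).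
    pose proof (RInt_sub_bound (fun y => Re (F (s, y))) (fun _ => 0) 0 (2 * PI) (Re (f c)) e) as L.
    rewrite RInt_const in L.
    change (scal (2 * PI - 0) 0) with ((2 * PI - 0) * 0) in L. rewrite Rmult_0_r in L.
    rewrite !Rminus_0_r in L. rewrite (Rmult_comm (2 * PI)). apply L; [lra|apply EF; assumption|apply ex_RInt_const|].
    intros t _. rewrite Rminus_0_r.
    replace (Re (F (s, t)) - Re (f c)) with (Re (F (s, t) - f c)) by (unfold Re; simpl; ring).
    eapply Rle_trans; [apply re_le_Cmod|]. left. apply H.
    replace (c + Cexp (s, t) - c)%C with (Cexp (s, t)) by ring. rewrite Cmod_Cexp. exact S2. }
  destruct (Req_dec (I - 2 * PI * Re (f c)) 0) as [E|N]; [lra|].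
  apply Rabs_pos_lt in N.
  specialize (B (Rabs (I - 2 * PI * Re (f c)) / (4 * PI))).
  assert (0 < Rabs (I - 2 * PI * Re (f c)) / (4 * PI)) by (apply Rdiv_lt_0_compat; lra).
  specialize (B H). replace (Rabs (I - 2 * PI * Re (f c)) / (4 * PI) * (2 * PI))
    with (Rabs (I - 2 * PI * Re (f c)) / 2) in B by (field; lra). lra.
Qed.

(** * Maximum principle and Schwarz-Pick lemma *)

Lemma Cmod2_Re_Im (z : C) : Cmod z * Cmod z = Re z * Re z + Im z * Im z.
Proof. pose proof (Cmod2_alt z) as H. simpl in H. lra. Qed.

Lemma Cmod_le_of_sqr (a : C) (M : R) : 0 <= M -> Cmod a * Cmod a <= M * M -> Cmod a <= M.
Proof. intros HM H. apply Rsqr_incr_0_var; assumption. Qed.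

(* At an interior maximum [z0] of [|F|^2 + e |z|^2], this function dominates on small circles around
   [z0] the real part of a function holomorphic near [z0] plus [e rho^2], contradicting the mean
   value property. *)
Lemma max_principle (F : C -> C) (r M : R) : 0 < r ->
  (forall z, Cmod z <= r -> ccont F z) ->
  (forall c, Cmod c < r -> exists d, 0 < d /\
     forall z, 0 < Cmod (z - c) < d -> exists l, cderiv F z l) ->
  (forall z, Cmod z = r -> Cmod (F z) <= M) ->
  forall z, Cmod z <= r -> Cmod (F z) <= M.
Proof.
  intros Hr K D HM z Hz.
  assert (HM0 : 0 <= M).
  { eapply Rle_trans; [apply Cmod_ge_0|apply (HM (RtoC r))]. apply Cmod_RtoC_pos; lra. }
  apply Cmod_le_of_sqr; [exact HM0|].
  assert (Q : forall e, 0 < e -> Cmod (F z) * Cmod (F z) <= M * M + e * (r * r)).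
  { intros e He.
    destruct (disc_max (RtoC 0) r (fun w => Cmod (F w) * Cmod (F w) + e * (Cmod w * Cmod w)))
      as [z0 [Hz0 Hmax]]; [lra| |].
    { intros w Hw. replace (w - RtoC 0)%C with w in Hw by ring.
      apply (ccont_ext (fun w => RtoC (Cmod (F w)) * RtoC (Cmod (F w)) + RtoC e * (RtoC (Cmod w) * RtoC (Cmod w)))%C).
      { intros v. rewrite <- !RtoC_mult, <- RtoC_plus. reflexivity. }
      apply ccont_plus; apply ccont_mult; try apply ccont_mult;
        auto using ccont_Cmod, ccont_const, ccont_id. }
    assert (E0 : forall w : C, (w - RtoC 0)%C = w) by (intros; ring).
    rewrite E0 in Hz0.
    assert (L := Hmax z). rewrite E0 in L. specialize (L Hz). simpl in L.
    assert (0 <= e * (Cmod z * Cmod z)).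
    { pose proof (Cmod_ge_0 z). apply Rmult_le_pos; [lra|]. apply Rmult_le_pos; assumption. }
    destruct (Rle_lt_or_eq_dec _ _ Hz0) as [Hlt|Heq].
    2:{ rewrite Heq in L. specialize (HM z0 Heq).
        pose proof (Cmod_ge_0 (F z0)). nra. }
    exfalso. destruct (D z0 Hlt) as [d [Hd HD]].
    set (m := Rmin d (r - Cmod z0)).
    assert (Hm : 0 < m) by (apply Rmin_pos; lra).
    assert (m <= d) by apply Rmin_l. assert (m <= r - Cmod z0) by apply Rmin_r.
    (* Expanding squares around [z0] gives [|F w|^2 + e |w|^2 = Re (f w) + |F w - F z0|^2 + e |w -
       z0|^2], with equality of the maximum and [Re (f z0)]. Thus
       [Re (f w) <= Re (f z0) - e |w - z0|^2]. *)
    set (f := fun w => (RtoC 2 * Cconj (F z0) * F w + (RtoC (e * (Cmod z0 * Cmod z0) - Cmod (F z0) * Cmod (F z0))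
       + RtoC (2 * e) * Cconj z0 * (w - z0)))%C).
    assert (Hx : exp (ln (m / 2)) = m / 2) by (apply exp_ln; lra).
    destruct (mean_value f z0 m (ln (m / 2)) Hm) as [I1 I2].
    - unfold f. apply ccont_plus; [apply ccont_mult; [apply ccont_const|apply K; lra]|].
      apply ccont_plus; [apply ccont_const|]. apply ccont_mult; [apply ccont_const|].
      apply ccont_minus; [apply ccont_id|apply ccont_const].
    - intros w Hw. destruct (HD w) as [l Hl]; [lra|]. eexists. unfold f.
      apply cderiv_plus; [apply cderiv_scale, Hl|].
      apply cderiv_plus; [apply cderiv_const|]. apply cderiv_scale.
      apply cderiv_minus; [apply cderiv_id|apply cderiv_const].
    - lra.
    - assert (Ef : Re (f z0) = Cmod (F z0) * Cmod (F z0) + e * (Cmod z0 * Cmod z0)).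
      { unfold f. replace (z0 - z0)%C with (RtoC 0) by ring.
        pose proof (Cmod2_Re_Im (F z0)) as E1.
        unfold Re, Im, Cconj in *; simpl in *. nra. }
      assert (B : RInt (fun y => Re (f (z0 + Cexp (ln (m / 2), y))%C)) 0 (2 * PI)
         <= RInt (fun _ => Re (f z0) - e * (m / 2 * (m / 2))) 0 (2 * PI)).
      { pose proof PI_RGT_0. apply RInt_le; [lra|exact I1|apply ex_RInt_const|].
        intros y _. set (w := (z0 + Cexp (ln (m / 2), y))%C).
        assert (Ew : Cmod (w - z0) = m / 2).
        { unfold w. replace (z0 + Cexp (ln (m / 2), y) - z0)%C with (Cexp (ln (m / 2), y)) by ring.
          rewrite Cmod_Cexp. exact Hx. }
        assert (Hw : Cmod w <= r).
        { pose proof (Cmod_triangle (w - z0) z0) as T.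
          replace (w - z0 + z0)%C with w in T by ring. lra. }
        specialize (Hmax w). rewrite E0 in Hmax. specialize (Hmax Hw). simpl in Hmax.
        rewrite <- Ew. rewrite Ef.
        pose proof (Cmod2_Re_Im (F w - F z0)) as S0. pose proof (Cmod2_Re_Im (F w)) as S1.
        pose proof (Cmod2_Re_Im (F z0)) as S2. pose proof (Cmod2_Re_Im z0) as S3.
        pose proof (Cmod2_Re_Im w) as S4. pose proof (Cmod2_Re_Im (w - z0)) as S5.
        assert (S6 : 0 <= Cmod (F w - F z0) * Cmod (F w - F z0))
          by (apply Rmult_le_pos; apply Cmod_ge_0).
        eapply Rle_trans; [|apply Rplus_le_compat_r; exact Hmax].
        unfold f. rewrite S5, S1, S4. rewrite S0 in S6.
        rewrite S2, S3. clear - S6 He.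
        destruct (F w) as [a b], (F z0) as [a0 b0], w as [p q], z0 as [p0 q0].
        unfold Re, Im, Cconj in *; simpl in *.
        assert (0 <= e) by lra. nra. }
      rewrite I2, RInt_const in B.
      change (scal (2 * PI - 0) (Re (f z0) - e * (m / 2 * (m / 2))))
        with ((2 * PI - 0) * (Re (f z0) - e * (m / 2 * (m / 2)))) in B.
      pose proof PI_RGT_0.
      assert (0 < e * (m / 2 * (m / 2))) by (apply Rmult_lt_0_compat; [lra|nra]).
      assert (0 < 2 * PI * (e * (m / 2 * (m / 2)))) by (apply Rmult_lt_0_compat; lra).
      lra. }
  apply Rnot_lt_le. intros L.
  set (x := Cmod (F z) * Cmod (F z)) in *.
  specialize (Q ((x - M * M) / (2 * (r * r)))).
  assert (0 < r * r) by nra.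
  assert (0 < (x - M * M) / (2 * (r * r))) by (apply Rdiv_lt_0_compat; lra).
  specialize (Q H0). replace ((x - M * M) / (2 * (r * r)) * (r * r)) with ((x - M * M) / 2) in Q by (field; nra).
  lra.
Qed.

(** The inequality is required only at some points arbitrarily close to [p], so that limits can be
    taken along a ray or along real [t < 1]. *)
Lemma Cmod_le_limit (G H : C -> C) (p : C) : ccont G p -> ccont H p ->
  (forall d, 0 < d -> exists w, Cmod (w - p) < d /\ Cmod (G w) <= Cmod (H w)) ->
  Cmod (G p) <= Cmod (H p).
Proof.
  intros KG KH A. apply Rnot_lt_le. intros L.
  set (e := (Cmod (G p) - Cmod (H p)) / 2). assert (He : 0 < e) by (unfold e; lra).
  destruct (KG e He) as [d1 [Hd1 H1]]. destruct (KH e He) as [d2 [Hd2 H2]].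
  destruct (A (Rmin d1 d2)) as [w [Hw Le]]. apply Rmin_pos; assumption.
  pose proof (Rmin_l d1 d2). pose proof (Rmin_r d1 d2).
  specialize (H1 w ltac:(lra)). specialize (H2 w ltac:(lra)).
  pose proof (Cmod_sub_ge (G p) (G w)) as T1. rewrite Cmod_sub_sym in T1.
  pose proof (Cmod_sub_ge (H w) (H p)) as T2. unfold e in *. lra.
Qed.

(* No differentiability is assumed at 0.  The maximum principle for the difference quotient based at
   [a] gives [|f z - f a| / |z - a| <= (1 + |f a|) / (r - |a|)]; let [a -> 0], then [r -> 1]. *)
Lemma schwarz (f : C -> C) :
  (forall z, Cmod z < 1 -> ccont f z) ->
  (forall z, 0 < Cmod z < 1 -> exists l, cderiv f z l) ->
  f (RtoC 0) = RtoC 0 -> (forall z, Cmod z < 1 -> Cmod (f z) <= 1) ->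
  forall z, Cmod z < 1 -> Cmod (f z) <= Cmod z.
Proof.
  intros K D F0 F1 z Hz.
  assert (Step1 : forall r a, Cmod z < r < 1 -> 0 < Cmod a < r ->
    Cmod ((f z - f a) * RtoC (r - Cmod a)) <= Cmod ((z - a) * RtoC (1 + Cmod (f a)))).
  { intros r a Hr Ha. destruct (D a) as [l Hl]; [lra|].
    (* [phi] is the difference quotient based at [a], already extended continuously to [a]; the
       maximum principle applies to it directly. *)
    apply cderiv_carath in Hl. destruct Hl as [phi [Ep [Kp Hp]]].
    assert (Hphi : forall w, w <> a -> ((f w - f a) / (w - a))%C = phi w).
    { intros w Hw. rewrite Hp. field. apply Cminus_eq_contra; exact Hw. }
    assert (Hne : forall c w : C, Cmod (w - c) < Cmod (c - a) -> w <> a).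
    { intros c w Hw E. subst w. rewrite Cmod_sub_sym in Hw. lra. }
    assert (P : Cmod (phi z) <= (1 + Cmod (f a)) / (r - Cmod a)).
    { apply (max_principle phi r); [lra| | | |lra].
      - intros c Hc. destruct (Ceq_dec c a) as [->|N]; [exact Kp|].
        assert (N' : (c - a)%C <> RtoC 0) by (apply Cminus_eq_contra; exact N).
        apply (ccont_ext_loc (fun w => (f w - f a) / (w - a))%C _ c (Cmod (c - a))).
        apply Cmod_pos; exact N'.
        { intros w Hw. apply Hphi; eauto. }
        apply ccont_div; [| |exact N'].
        + apply ccont_minus; [apply K; lra|apply ccont_const].
        + apply ccont_minus; [apply ccont_id|apply ccont_const].
      - intros c Hc.
        (* The derivative of [phi] may be missing at 0, because of [f], and at [a], because of the
           division; a small punctured disc around [c] avoids both. *)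
        assert (Q : exists d, 0 < d /\ forall w, 0 < Cmod (w - c) < d -> w <> RtoC 0 /\ w <> a /\ Cmod w < 1).
        { assert (G : forall p : C, exists d, 0 < d /\ forall w, 0 < Cmod (w - c) < d -> w <> p).
          { intros p. destruct (Ceq_dec c p) as [->|N].
            - exists 1. split; [lra|]. intros w Hw E. subst w. rewrite Cmod_diag in Hw. lra.
            - exists (Cmod (c - p)). split. apply Cmod_pos, Cminus_eq_contra, N.
              intros w Hw E. subst w. rewrite Cmod_sub_sym in Hw. lra. }
          destruct (G (RtoC 0)) as [d1 [Hd1 G1]]. destruct (G a) as [d2 [Hd2 G2]].
          exists (Rmin (Rmin d1 d2) (1 - r)).
          pose proof (Rmin_l (Rmin d1 d2) (1 - r)). pose proof (Rmin_r (Rmin d1 d2) (1 - r)).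
          pose proof (Rmin_l d1 d2). pose proof (Rmin_r d1 d2).
          split. apply Rmin_pos; [apply Rmin_pos; assumption|lra].
          intros w Hw. split; [apply G1; lra|]. split; [apply G2; lra|].
          pose proof (Cmod_sub_ge w c). lra. }
        destruct Q as [d [Hd Q]]. exists d. split; [exact Hd|].
        intros w Hw. destruct (Q w Hw) as [W1 [W2 W3]].
        destruct (D w) as [lw Hlw]. split; [apply Cmod_pos; exact W1|exact W3].
        assert (N' : (w - a)%C <> RtoC 0) by (apply Cminus_eq_contra; exact W2).
        destruct (cderiv_div (fun v => f v - f a)%C (fun v => v - a)%C w (lw - RtoC 0) (RtoC 1 - RtoC 0))
          as [k Hk]; [| |exact N'|].
        + apply cderiv_minus; [exact Hlw|apply cderiv_const].
        + apply cderiv_minus; [apply cderiv_id|apply cderiv_const].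
        + exists k. apply (cderiv_ext_loc (fun v => (f v - f a) / (v - a))%C _ _ _ (Cmod (w - a))).
          apply Cmod_pos; exact N'.
          { intros v Hv. apply Hphi; eauto. }
          exact Hk.
      (* On the circle of radius [r], the numerator is at most [1 + |f a|] and the denominator at
         least [r - |a|]. *)
      - intros w Hw.
        pose proof (Cmod_sub_ge w a) as T1. rewrite Hw in T1.
        pose proof (Cmod_sub_le (f w) (f a)) as T2. rewrite (Hp w), Cmod_mult in T2.
        pose proof (F1 w ltac:(lra)). pose proof (Cmod_ge_0 (phi w)).
        apply Rle_div_r; [lra|]. nra. }
    rewrite Hp, !Cmod_mult, !Cmod_RtoC_pos by (pose proof (Cmod_ge_0 (f a)); lra).
    pose proof (Cmod_ge_0 (z - a)).
    replace (Cmod (phi z) * Cmod (z - a) * (r - Cmod a))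
      with (Cmod (z - a) * (Cmod (phi z) * (r - Cmod a))) by ring.
    apply Rmult_le_compat_l; [assumption|]. apply Rle_div_r; [lra|exact P]. }
  assert (Step2 : forall r, Cmod z < r < 1 -> Cmod (f z * RtoC r) <= Cmod z).
  { intros r Hr. pose proof (Cmod_ge_0 z).
    assert (L : Cmod ((f z - f (RtoC 0)) * RtoC (r - Cmod (RtoC 0)))
       <= Cmod ((z - RtoC 0) * RtoC (1 + Cmod (f (RtoC 0))))).
    { assert (K0 : ccont f (RtoC 0)) by (apply K; rewrite Cmod_0; lra).
      apply (Cmod_le_limit (fun a => (f z - f a) * RtoC (r - Cmod a))%C
        (fun a => (z - a) * RtoC (1 + Cmod (f a)))%C).
      - apply ccont_mult; [apply ccont_minus; auto using ccont_const|].
        apply (ccont_ext (fun a => RtoC r - RtoC (Cmod a))%C); [intros; rewrite RtoC_minus; reflexivity|].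
        apply ccont_minus; [apply ccont_const|apply ccont_Cmod, ccont_id].
      - apply ccont_mult; [apply ccont_minus; auto using ccont_const, ccont_id|].
        apply (ccont_ext (fun a => RtoC 1 + RtoC (Cmod (f a)))%C); [intros; rewrite RtoC_plus; reflexivity|].
        apply ccont_plus; [apply ccont_const|apply ccont_Cmod, K0].
      - intros d Hd. set (m := Rmin d r / 2).
        assert (0 < Rmin d r) by (apply Rmin_pos; lra).
        pose proof (Rmin_l d r). pose proof (Rmin_r d r).
        assert (Em : Cmod (RtoC m) = m) by (apply Cmod_RtoC_pos; unfold m; lra).
        exists (RtoC m). split.
        + replace (RtoC m - RtoC 0)%C with (RtoC m) by ring. rewrite Em. unfold m; lra.
        + apply Step1; [exact Hr|]. rewrite Em. unfold m; lra. }
    rewrite F0, Cmod_0, Rminus_0_r, Rplus_0_r in L.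
    replace ((f z - RtoC 0) * RtoC r)%C with (f z * RtoC r)%C in L by ring.
    replace ((z - RtoC 0) * RtoC 1)%C with z in L by ring. exact L. }
  replace (f z) with (f z * RtoC 1)%C by ring.
  apply (Cmod_le_limit (fun w => f z * w)%C (fun _ => z)).
  - apply ccont_mult; [apply ccont_const|apply ccont_id].
  - apply ccont_const.
  - intros d Hd. set (m := Rmin d (1 - Cmod z) / 2).
    assert (0 < Rmin d (1 - Cmod z)) by (apply Rmin_pos; lra).
    pose proof (Rmin_l d (1 - Cmod z)). pose proof (Rmin_r d (1 - Cmod z)).
    exists (RtoC (1 - m)). split.
    + rewrite <- RtoC_minus, Cmod_R. replace (1 - m - 1) with (- m) by ring.
      rewrite Rabs_Ropp, Rabs_pos_eq; unfold m; lra.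
    + apply Step2. unfold m; lra.
Qed.

Lemma mobius_denominator (b w : C) : Cmod b < 1 -> Cmod w <= 1 ->
  (RtoC 1 - Cconj b * w)%C <> RtoC 0.
Proof.
  intros Hb Hw. apply Cmod_pos_neq.
  pose proof (Cmod_sub_ge (RtoC 1) (Cconj b * w)) as T.
  rewrite Cmod_1, Cmod_mult, Cmod_conj in T.
  pose proof (Cmod_ge_0 b). pose proof (Cmod_ge_0 w). nra.
Qed.

(** Composing [f] with the disc automorphism that sends [f 0] to 0 reduces this to [schwarz]. *)
Lemma schwarz_pick (f : C -> C) :
  (forall z, Cmod z < 1 -> ccont f z) ->
  (forall z, 0 < Cmod z < 1 -> exists l, cderiv f z l) ->
  Cmod (f (RtoC 0)) < 1 -> (forall z, Cmod z < 1 -> Cmod (f z) <= 1) ->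
  forall z, Cmod z < 1 ->
  Cmod (f z - f (RtoC 0)) <= Cmod z * Cmod (RtoC 1 - Cconj (f (RtoC 0)) * f z).
Proof.
  intros K D F0 F1 z Hz. set (b := f (RtoC 0)) in *.
  assert (N : forall w, Cmod w < 1 -> (RtoC 1 - Cconj b * f w)%C <> RtoC 0)
    by (intros w Hw; apply mobius_denominator; auto).
  assert (L : Cmod ((f z - b) / (RtoC 1 - Cconj b * f z)) <= Cmod z).
  { apply (schwarz (fun w => (f w - b) / (RtoC 1 - Cconj b * f w))%C); [| | | |exact Hz].
    - intros w Hw. apply ccont_div; [| |auto].
      + apply ccont_minus; auto using ccont_const.
      + apply ccont_minus; [apply ccont_const|apply ccont_mult; auto using ccont_const].
    - intros w Hw. destruct (D w Hw) as [l Hl]. eapply cderiv_div.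
      + apply cderiv_minus; [exact Hl|apply cderiv_const].
      + apply cderiv_minus; [apply cderiv_const|apply cderiv_scale, Hl].
      + apply N; lra.
    - fold b. replace (b - b)%C with (RtoC 0) by ring. apply Cmult_0_l.
    - intros w Hw. specialize (N w Hw). rewrite Cmod_div by exact N. apply Cmod_pos in N.
      apply Rle_div_l; [exact N|]. rewrite Rmult_1_l. apply Cmod_le_of_sqr; [lra|].
      specialize (F1 w Hw).
      (* This product equals [|1 - conj b * w|^2 - |w - b|^2] for [w] replaced by [f w]. *)
      assert (S : 0 <= (1 - Cmod b * Cmod b) * (1 - Cmod (f w) * Cmod (f w))).
      { pose proof (Cmod_ge_0 b). pose proof (Cmod_ge_0 (f w)). apply Rmult_le_pos; nra. }
      rewrite !Cmod2_Re_Im in *. clear - S.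
      destruct (f w) as [p q], b as [s t]. unfold Re, Im, Cconj in *; simpl in *. nra. }
  specialize (N z Hz). rewrite Cmod_div in L by exact N. apply Cmod_pos in N.
  apply Rle_div_l in L; [exact L|exact N].
Qed.

(** Put [x = |w|] and [a = |b|]. After squaring, [Re (conj b * w) <= a x] leaves
    [(x - a)^2 <= r^2 (1 - a x)^2]. As a difference of squares this says that [x] lies between the
    roots [(a - r) / (1 - a r)] and [(a + r) / (1 + a r)]. *)
Lemma schwarz_pick_bounds (b w : C) (r : R) : Cmod b < 1 -> 0 <= r < 1 ->
  Cmod (w - b) <= r * Cmod (RtoC 1 - Cconj b * w) ->
  Cmod b - r <= Cmod w * (1 - Cmod b * r) /\ Cmod w * (1 + Cmod b * r) <= Cmod b + r.
Proof.
  intros Hb Hr H.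
  assert (H2 : Cmod (w - b) * Cmod (w - b) <= r * r * (Cmod (RtoC 1 - Cconj b * w) * Cmod (RtoC 1 - Cconj b * w))).
  { replace (r * r * (Cmod (RtoC 1 - Cconj b * w) * Cmod (RtoC 1 - Cconj b * w)))
     with ((r * Cmod (RtoC 1 - Cconj b * w)) * (r * Cmod (RtoC 1 - Cconj b * w))) by ring.
    apply Rmult_le_compat; auto using Cmod_ge_0. }
  assert (X : Re (Cconj b * w) <= Cmod b * Cmod w).
  { pose proof (re_le_Cmod (Cconj b * w)) as T. rewrite Cmod_mult, Cmod_conj in T.
    apply Rabs_le_between in T. lra. }
  pose proof (Cmod_ge_0 b) as B0. pose proof (Cmod_ge_0 w) as W0.
  assert (E1 : Cmod (w - b) * Cmod (w - b) = Cmod w * Cmod w + Cmod b * Cmod b - 2 * Re (Cconj b * w)).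
  { rewrite !Cmod2_Re_Im. destruct w, b. unfold Re, Im, Cconj; simpl. ring. }
  assert (E2 : Cmod (RtoC 1 - Cconj b * w) * Cmod (RtoC 1 - Cconj b * w)
    = 1 + (Cmod b * Cmod b) * (Cmod w * Cmod w) - 2 * Re (Cconj b * w)).
  { rewrite !Cmod2_Re_Im. destruct w, b. unfold Re, Im, Cconj; simpl. ring. }
  rewrite E1, E2 in H2. set (x := Cmod w) in *. set (a := Cmod b) in *. set (y := Re (Cconj b * w)) in *.
  assert (P : (x * (1 + a * r) - (a + r)) * (x * (1 - a * r) - (a - r)) <= 0).
  { assert (y * (1 - r * r) <= a * x * (1 - r * r)) by (apply Rmult_le_compat_r; nra). nra. }
  assert (0 <= a * r < 1) by nra.
  assert (O : (a - r) * (1 + a * r) <= (a + r) * (1 - a * r)) by nra.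
  split; apply Rnot_lt_le; intros L.
  - assert (x * (1 + a * r) < a + r).
    { apply Rmult_lt_reg_r with (1 - a * r); [lra|]. nra. }
    nra.
  - assert (a - r < x * (1 - a * r)).
    { apply Rmult_lt_reg_r with (1 + a * r); [lra|]. nra. }
    nra.
Qed.

(** * Starlike maps *)

(* A minimum of [|h - w|] over a small disc is interior when [w] is close to [h z], and it must be 0:
   otherwise moving from it in the direction [-(h - w) / h'] would decrease [|h - w|]. *)
Lemma locally_onto (h : C -> C) (z : C) (eps : R) :
  (forall w, Cmod w < 1 -> exists l, l <> RtoC 0 /\ cderiv h w l) ->
  Cmod z < 1 -> 0 < eps ->
  exists d, 0 < d /\ forall w, Cmod (w - h z) < d ->
    exists v, Cmod v < 1 /\ Cmod (v - z) < eps /\ h v = w.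
Proof.
  intros D Hz He. destruct (D z Hz) as [l [Nl Dl]]. apply Cmod_pos in Nl.
  destruct (Dl (Cmod l / 2)) as [d0 [Hd0 HD0]]; [lra|].
  set (rho := Rmin (Rmin d0 eps) (1 - Cmod z) / 2).
  pose proof (Rmin_l (Rmin d0 eps) (1 - Cmod z)). pose proof (Rmin_r (Rmin d0 eps) (1 - Cmod z)).
  pose proof (Rmin_l d0 eps). pose proof (Rmin_r d0 eps).
  assert (0 < Rmin (Rmin d0 eps) (1 - Cmod z)) by (apply Rmin_pos; [apply Rmin_pos; assumption|lra]).
  assert (Hrho : 0 < rho) by (unfold rho; lra).
  assert (Hin : forall v, Cmod (v - z) <= rho -> Cmod v < 1).
  { intros v Hv. pose proof (Cmod_sub_ge v z). unfold rho in Hv. lra. }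
  (* On the boundary circle [|h v - h z| >= |l| rho / 2]. For [w] this close to [h z], boundary
     values are farther from [w] than [h z] is, so the minimum is not there. *)
  exists (Cmod l * rho / 4). split. assert (0 < Cmod l * rho) by nra. lra.
  intros w Hw.
  destruct (disc_max z rho (fun v => - Cmod (h v - w))) as [z1 [Hz1 Hmin]]; [lra| |].
  { intros v Hv. destruct (D v (Hin v Hv)) as [m [_ Dm]].
    apply (ccont_ext (fun v => - RtoC 1 * RtoC (Cmod (h v - w)))%C).
    { intros u. rewrite RtoC_opp. ring. }
    apply ccont_mult; [apply ccont_const|]. apply ccont_Cmod.
    apply ccont_minus; [exact (cderiv_ccont _ _ _ Dm)|apply ccont_const]. }
  exists z1. split; [exact (Hin z1 Hz1)|]. split; [unfold rho in Hz1; lra|].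
  destruct (Ceq_dec (h z1) w) as [E|N]; [exact E|exfalso].
  destruct (Rle_lt_or_eq_dec _ _ Hz1) as [Hlt|Heq].
  - destruct (D z1 (Hin z1 Hz1)) as [l1 [Nl1 D1]].
    set (u := (h z1 - w)%C). assert (Nu : u <> RtoC 0) by (apply Cminus_eq_contra; exact N).
    assert (Pl1 := Cmod_pos _ Nl1). assert (Pu := Cmod_pos _ Nu).
    destruct (D1 (Cmod l1 / 2)) as [d1 [Hd1 HD1]]; [lra|].
    set (m := Rmin d1 (rho - Cmod (z1 - z))). assert (Hm : 0 < m) by (apply Rmin_pos; lra).
    assert (m <= d1) by apply Rmin_l. assert (m <= rho - Cmod (z1 - z)) by apply Rmin_r.
    (* The length of a full Newton step [u / l1]; the fraction [t] of it stays inside the disc and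
       within the range of the linear approximation. *)
    set (k := Cmod u / Cmod l1). assert (Hk : 0 < k) by (apply Rdiv_lt_0_compat; assumption).
    set (t := Rmin 1 (m / (2 * k))).
    assert (0 < m / (2 * k)) by (apply Rdiv_lt_0_compat; lra).
    assert (Ht : 0 < t) by (apply Rmin_pos; lra).
    assert (Ht1 : t <= 1) by apply Rmin_l.
    assert (Htk : t * k < m).
    { apply Rle_lt_trans with (m / (2 * k) * k). apply Rmult_le_compat_r; [lra|apply Rmin_r].
      replace (m / (2 * k) * k) with (m / 2) by (field; lra). lra. }
    set (v := (z1 - RtoC t * (u / l1))%C).
    assert (Ev : Cmod (v - z1) = t * k).
    { unfold v. replace (z1 - RtoC t * (u / l1) - z1)%C with (- (RtoC t * (u / l1)))%C by ring.
      rewrite Cmod_opp, Cmod_mult, Cmod_div, Cmod_RtoC_pos by (auto; lra). reflexivity. }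
    assert (Hv : Cmod (v - z) <= rho).
    { pose proof (Cmod_triangle_via v z1 z). lra. }
    specialize (Hmin v Hv). specialize (HD1 v ltac:(lra)). rewrite Ev in HD1.
    (* The remainder is at most [t |u| / 2], so [|h v - w| <= (1 - t / 2) |u|], below the
       minimum. *)
    assert (Eh : (h v - w)%C = (RtoC (1 - t) * u + (h v - h z1 - l1 * (v - z1)))%C).
    { rewrite RtoC_minus. unfold v at 3, u. field. exact Nl1. }
    pose proof (Cmod_triangle (RtoC (1 - t) * u) (h v - h z1 - l1 * (v - z1))) as T.
    rewrite <- Eh, Cmod_mult, Cmod_RtoC_pos in T by lra.
    fold u in Hmin.
    replace (Cmod l1 / 2 * (t * k)) with (t * Cmod u / 2) in HD1 by (unfold k; field; lra).
    assert (0 < t * Cmod u) by nra. lra.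
  - specialize (HD0 z1). assert (L : Cmod (z1 - z) < d0) by (unfold rho in Heq; lra).
    specialize (HD0 L). specialize (Hmin z). rewrite Cmod_diag in Hmin. specialize (Hmin ltac:(lra)).
    pose proof (Cmod_sub_ge (l * (z1 - z)) (l * (z1 - z) - (h z1 - h z))) as T1.
    replace (l * (z1 - z) - (l * (z1 - z) - (h z1 - h z)))%C with (h z1 - h z)%C in T1 by ring.
    rewrite (Cmod_sub_sym (l * (z1 - z))) in T1. rewrite Cmod_mult in T1.
    pose proof (Cmod_triangle_via (h z1) w (h z)) as T2.
    rewrite Heq in *. rewrite (Cmod_sub_sym w (h z)) in *. rewrite (Cmod_sub_sym (h z) w) in *.
    assert (0 < Cmod l * rho) by nra. rewrite (Cmod_sub_sym w (h z)) in *. lra.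
Qed.

(** [locally_onto] and injectivity make [k] continuous at [h z]. If [phi] is the slope of [h] at
    [z], then [w - h z = phi (k w) * (k w - z)] near [h z], so [k] has the continuous slope
    [1 / phi (k w)]. Off the image of the disc, [k] takes arbitrary values. *)
Lemma holomorphic_inverse (h h' : C -> C) :
  (forall z, Cmod z < 1 -> cderiv h z (h' z)) ->
  (forall z, Cmod z < 1 -> h' z <> RtoC 0) ->
  (forall z1 z2, Cmod z1 < 1 -> Cmod z2 < 1 -> h z1 = h z2 -> z1 = z2) ->
  exists k, (forall z, Cmod z < 1 -> k (h z) = z) /\
    (forall z, Cmod z < 1 -> cderiv k (h z) (/ h' z)%C).
Proof.
  intros D N I.
  exists (fun w => epsilon (inhabits (RtoC 0)) (fun z => Cmod z < 1 /\ h z = w)).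
  set (k := fun w => epsilon (inhabits (RtoC 0)) (fun z => Cmod z < 1 /\ h z = w)).
  assert (Kh : forall z, Cmod z < 1 -> k (h z) = z).
  { intros z Hz.
    destruct (epsilon_spec (inhabits (RtoC 0)) (fun v => Cmod v < 1 /\ h v = h z)) as [E1 E2].
    - exists z; auto.
    - apply I; assumption. }
  split; [exact Kh|]. intros z Hz.
  assert (S : forall eps, 0 < eps -> exists d, 0 < d /\ forall w, Cmod (w - h z) < d ->
    Cmod (k w - z) < eps /\ h (k w) = w).
  { intros eps He. destruct (locally_onto h z eps) as [d [Hd H]]; auto.
    { intros w Hw. exists (h' w). auto. }
    exists d. split; [exact Hd|]. intros w Hw. destruct (H w Hw) as [v [Hv1 [Hv2 Hv3]]].
    rewrite <- Hv3, (Kh v Hv1). auto. }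
  assert (Kc : ccont k (h z)).
  { intros eps He. destruct (S eps He) as [d [Hd H]]. exists d. split; [exact Hd|].
    intros w Hw. rewrite (Kh z Hz). apply (H w Hw). }
  pose proof (D z Hz) as Dz. apply cderiv_carath in Dz. destruct Dz as [phi [Ep [Kp Hp]]].
  assert (Kphi : ccont (fun w => phi (k w)) (h z)).
  { apply ccont_comp; [exact Kc|]. rewrite (Kh z Hz). exact Kp. }
  assert (Nphi : phi (k (h z)) <> RtoC 0) by (rewrite (Kh z Hz), Ep; auto).
  destruct (ccont_lower _ _ Kphi Nphi) as [d1 [Hd1 H1]].
  destruct (S 1 Rlt_0_1) as [d2 [Hd2 H2]].
  apply (cderiv_ext_loc (fun w => z + / phi (k w) * (w - h z))%C _ _ _ (Rmin d1 d2)).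
  - apply Rmin_pos; assumption.
  - intros w Hw. pose proof (Rmin_l d1 d2). pose proof (Rmin_r d1 d2).
    specialize (H1 w ltac:(lra)). destruct (H2 w ltac:(lra)) as [_ E].
    assert (phi (k w) <> RtoC 0).
    { apply Cmod_pos_neq. apply Cmod_pos in Nphi. lra. }
    pose proof (Hp (k w)) as Q. rewrite E in Q. rewrite Q. field. assumption.
  - apply cderiv_carath. exists (fun w => / phi (k w))%C. split; [rewrite (Kh z Hz), Ep; reflexivity|].
    split; [apply ccont_inv; assumption|]. intros w. ring.
Qed.

Lemma increasing_of_derive (f df : R -> R) (a b : R) : a <= b ->
  (forall x, a <= x <= b -> is_derive f x (df x)) -> (forall x, a <= x <= b -> 0 <= df x) -> f a <= f b.
Proof.
  intros Hab D P. destruct (MVT_gen f a b df) as [c [Hc E]].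
  - intros x Hx. apply D. rewrite Rmin_left, Rmax_right in Hx; lra.
  - intros x Hx. rewrite Rmin_left, Rmax_right in Hx by lra.
    apply derivable_continuous_pt. exists (df x). apply is_derive_Reals, D. lra.
  - rewrite Rmin_left, Rmax_right in Hc by lra. specialize (P c Hc). nra.
Qed.

(** The derivative is not known to be integrable, so the increment [u] is treated by monotonicity:
    [|u| M(s) - Re (conj u * F(s))] has derivative at least 0, and comparing the ends gives
    [|u|^2 <= |u| (M b - M a)]. *)
Lemma mean_value_inequality (F : C -> C) (M m : R -> R) (a b : R) : a <= b ->
  (forall s, a <= s <= b -> exists l, cderiv F (RtoC s) l /\ Cmod l <= m s) ->
  (forall s, a <= s <= b -> is_derive M s (m s)) ->
  Cmod (F (RtoC b) - F (RtoC a)) <= M b - M a.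
Proof.
  intros Hab DF DM. set (u := (F (RtoC b) - F (RtoC a))%C).
  pose proof (Cmod_ge_0 u) as U0.
  set (F' := fun s => epsilon (inhabits (RtoC 0)) (fun l => cderiv F (RtoC s) l /\ Cmod l <= m s)).
  assert (HF' : forall s, a <= s <= b -> cderiv F (RtoC s) (F' s) /\ Cmod (F' s) <= m s).
  { intros s Hs. unfold F'. apply epsilon_spec. exact (DF s Hs). }
  pose proof (increasing_of_derive
    (fun s => Cmod u * M s - Re (Cconj u * F (RtoC s)))
    (fun s => Cmod u * m s - Re (Cconj u * F' s)) a b Hab) as L.
  assert (L' : Cmod u * M a - Re (Cconj u * F (RtoC a)) <= Cmod u * M b - Re (Cconj u * F (RtoC b))).
  { apply L.
    - intros s Hs. destruct (HF' s Hs) as [D1 D2].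
      apply (is_derive_minus (fun s => Cmod u * M s) (fun s => Re (Cconj u * F (RtoC s)))).
      + apply is_derive_scal, DM, Hs.
      + apply (cderiv_Re (fun w => Cconj u * F w)%C). apply cderiv_scale, D1.
    - intros s Hs. destruct (HF' s Hs) as [D1 D2].
      pose proof (re_le_Cmod (Cconj u * F' s)) as T. rewrite Cmod_mult, Cmod_conj in T.
      apply Rabs_le_between in T. nra. }
  assert (E : Re (Cconj u * F (RtoC b)) - Re (Cconj u * F (RtoC a)) = Cmod u * Cmod u).
  { rewrite Cmod2_Re_Im. unfold u. destruct (F (RtoC b)), (F (RtoC a)).
    unfold Re, Im, Cconj; simpl. ring. }
  destruct (Req_dec (Cmod u) 0) as [Z|Z].
  - rewrite Z in *. pose proof (increasing_of_derive M m a b Hab DM) as Q.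
    assert (M a <= M b); [|lra]. apply Q. intros s Hs. destruct (HF' s Hs).
    pose proof (Cmod_ge_0 (F' s)). lra.
  - apply Rmult_le_reg_l with (Cmod u); nra.
Qed.

(** The slope of [f] at 0 serves as [f z / z], with value [l] at 0; the conclusions match the
    regularity hypotheses of [schwarz_pick]. *)
Lemma quotient_at_0 (f : C -> C) (l : C) : f (RtoC 0) = RtoC 0 -> cderiv f (RtoC 0) l ->
  (forall z, Cmod z < 1 -> exists m, cderiv f z m) ->
  exists q, q (RtoC 0) = l /\ (forall z, f z = q z * z)%C /\
    (forall z, Cmod z < 1 -> ccont q z) /\
    (forall z, 0 < Cmod z < 1 -> exists m, cderiv q z m).
Proof.
  intros F0 D0 D. apply cderiv_carath in D0. destruct D0 as [q [E [K H]]].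
  assert (Hq : forall z, (f z = q z * z)%C).
  { intros z. specialize (H z). rewrite F0 in H.
    replace (f z) with (f z - RtoC 0)%C by ring. rewrite H. ring. }
  assert (Dq : forall z, 0 < Cmod z < 1 -> exists m, cderiv q z m).
  { intros z Hz. assert (N : z <> RtoC 0) by (apply Cmod_pos_neq; lra).
    destruct (D z) as [m Hm]; [lra|].
    destruct (cderiv_div f (fun w => w) z m (RtoC 1) Hm (cderiv_id z) N) as [k Hk].
    exists k. apply (cderiv_ext_loc (fun w => f w / w)%C _ _ _ (Cmod z)); [lra| |exact Hk].
    intros w Hw. rewrite Hq. field. intros E0. subst w.
    replace (RtoC 0 - z)%C with (- z)%C in Hw by ring. rewrite Cmod_opp in Hw. lra. }
  exists q. split; [exact E|]. split; [exact Hq|]. split; [|exact Dq].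
  intros z Hz. destruct (Ceq_dec z (RtoC 0)) as [->|N]; [exact K|].
  destruct (Dq z) as [m Hm]. split; [apply Cmod_pos, N|exact Hz]. exact (cderiv_ccont _ _ _ Hm).
Qed.

(** * The flow of a starlike map *)

(** [k] matters only on the image of the disc. [sm_star] expresses starlikeness of that image
    through [k] itself: [t h(z)] is attained, and it is attained at [k (t h(z))]. *)
Record starlike_map (h h' k : C -> C) : Prop := {
  sm_deriv : forall z, Cmod z < 1 -> cderiv h z (h' z);
  sm_neq : forall z, Cmod z < 1 -> h' z <> RtoC 0;
  sm_0 : h (RtoC 0) = RtoC 0;
  sm_1 : h' (RtoC 0) = RtoC 1;
  sm_k : forall z, Cmod z < 1 -> k (h z) = z;
  sm_k_deriv : forall z, Cmod z < 1 -> cderiv k (h z) (/ h' z)%C;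
  sm_star : forall z t, Cmod z < 1 -> 0 <= t <= 1 ->
    Cmod (k (RtoC t * h z)%C) < 1 /\ h (k (RtoC t * h z)%C) = (RtoC t * h z)%C
}.

Lemma Cmod_0_lt_1 : Cmod (RtoC 0) < 1.
Proof. rewrite Cmod_0. lra. Qed.

Lemma sm_h_neq (h h' k : C -> C) (z : C) : starlike_map h h' k -> 0 < Cmod z < 1 -> h z <> RtoC 0.
Proof.
  intros S Hz E. assert (Q := sm_k _ _ _ S z (proj2 Hz)).
  rewrite E, <- (sm_0 _ _ _ S), (sm_k _ _ _ S _ Cmod_0_lt_1) in Q.
  rewrite <- Q, Cmod_0 in Hz. lra.
Qed.

Lemma sm_flow_deriv (h h' k : C -> C) (z : C) (t : R) : starlike_map h h' k ->
  Cmod z < 1 -> 0 <= t <= 1 ->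
  cderiv (fun w => k (RtoC t * h w)%C) z (RtoC t * h' z / h' (k (RtoC t * h z)%C))%C.
Proof.
  intros S Hz Ht. destruct (sm_star _ _ _ S z t Hz Ht) as [H1 H2].
  pose proof (sm_k_deriv _ _ _ S _ H1) as D. rewrite H2 in D.
  unfold Cdiv. rewrite Cmult_comm.
  apply (cderiv_comp (fun w => RtoC t * h w)%C k); [|exact D].
  apply cderiv_scale, (sm_deriv _ _ _ S), Hz.
Qed.

(** The scalar [u] is a complex variable, so that the slope of [k (u h(z))] at [u = 1] is a
    continuous complex function to which [Cmod_le_limit] applies. *)
Lemma sm_ray_deriv (h h' k : C -> C) (z : C) (t : R) : starlike_map h h' k ->
  Cmod z < 1 -> 0 <= t <= 1 ->
  cderiv (fun u => k (u * h z)%C) (RtoC t) (h z / h' (k (RtoC t * h z)%C))%C.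
Proof.
  intros S Hz Ht. destruct (sm_star _ _ _ S z t Hz Ht) as [H1 H2].
  pose proof (sm_k_deriv _ _ _ S _ H1) as D. rewrite H2 in D.
  unfold Cdiv. rewrite Cmult_comm.
  apply (cderiv_comp (fun u => u * h z)%C k); [|exact D].
  pose proof (cderiv_mult _ _ (RtoC t) _ _ (cderiv_id (RtoC t)) (cderiv_const (h z) (RtoC t))) as M.
  cbv beta in M. replace (RtoC 1 * h z + RtoC t * RtoC 0)%C with (h z) in M by ring. exact M.
Qed.

Lemma sm_flow_0 (h h' k : C -> C) (t : R) : starlike_map h h' k ->
  k (RtoC t * h (RtoC 0))%C = RtoC 0.
Proof.
  intros S. pose proof (sm_k _ _ _ S _ Cmod_0_lt_1) as Q.
  rewrite (sm_0 _ _ _ S) in *. rewrite Cmult_0_r. exact Q.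
Qed.

Lemma sm_flow_le (h h' k : C -> C) (z : C) (t : R) : starlike_map h h' k ->
  Cmod z < 1 -> 0 <= t <= 1 -> Cmod (k (RtoC t * h z)%C) <= Cmod z.
Proof.
  intros S Hz Ht. apply (schwarz (fun w => k (RtoC t * h w)%C)); [| | | |exact Hz].
  - intros w Hw. eapply cderiv_ccont, sm_flow_deriv; eauto.
  - intros w [_ Hw]. eexists. eapply sm_flow_deriv; eauto.
  - eapply sm_flow_0; eauto.
  - intros w Hw. left. apply (sm_star _ _ _ S w t Hw Ht).
Qed.

Lemma exists_near_1 (d : R) : 0 < d -> exists t, 0 <= t < 1 /\ Cmod (RtoC t - RtoC 1) < d.
Proof.
  intros Hd. exists (1 - Rmin d 1 / 2).
  pose proof (Rmin_l d 1). pose proof (Rmin_r d 1). assert (0 < Rmin d 1) by (apply Rmin_pos; lra).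
  split; [lra|]. rewrite <- RtoC_minus, Cmod_R.
  replace (1 - Rmin d 1 / 2 - 1) with (- (Rmin d 1 / 2)) by ring.
  rewrite Rabs_Ropp, Rabs_pos_eq; lra.
Qed.

(* Schwarz-Pick for [k (t * h z) / z], which takes the value [t] at 0; divide by [1 - t] and let
   [t -> 1]. *)
Lemma sm_log_derivative (h h' k : C -> C) (z : C) : starlike_map h h' k -> 0 < Cmod z < 1 ->
  Cmod (z * h' z / h z - RtoC 1) <= Cmod z * Cmod (z * h' z / h z + RtoC 1).
Proof.
  intros S Hz. assert (Nz : z <> RtoC 0) by (apply Cmod_pos_neq; lra).
  assert (Nh := sm_h_neq _ _ _ z S Hz). assert (Nh' := sm_neq _ _ _ S z (proj2 Hz)).
  pose proof (sm_ray_deriv _ _ _ z 1 S (proj2 Hz) ltac:(lra)) as D1.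
  rewrite Cmult_1_l, (sm_k _ _ _ S z (proj2 Hz)) in D1.
  (* Thus [k (t h(z)) = z + c(t) (t - 1)] with [c(1) = h(z) / h'(z)]. This makes the factor [1 - t]
     explicit on both sides of the Schwarz-Pick inequality. *)
  apply cderiv_carath in D1. destruct D1 as [c [Ec [Kc Hc]]].
  rewrite Cmult_1_l, (sm_k _ _ _ S z (proj2 Hz)) in Hc.
  assert (L : Cmod (RtoC 1 - c (RtoC 1) / z) <= Cmod (z * (RtoC 1 + RtoC 1 * c (RtoC 1) / z))).
  { apply (Cmod_le_limit (fun u => RtoC 1 - c u / z)%C (fun u => z * (RtoC 1 + u * c u / z))%C).
    - apply ccont_minus; [apply ccont_const|apply ccont_div; auto using ccont_const].
    - apply ccont_mult; [apply ccont_const|]. apply ccont_plus; [apply ccont_const|].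
      apply ccont_div; auto using ccont_const. apply ccont_mult; auto using ccont_id.
    - intros d Hd. destruct (exists_near_1 d Hd) as [t [Ht Ht']]. exists (RtoC t). split; [exact Ht'|].
      assert (Ht1 : 0 <= t <= 1) by lra.
      pose proof (sm_flow_deriv _ _ _ (RtoC 0) t S Cmod_0_lt_1 Ht1) as D0.
      rewrite (sm_flow_0 _ _ _ t S), (sm_1 _ _ _ S) in D0.
      replace (RtoC t * RtoC 1 / RtoC 1)%C with (RtoC t) in D0 by (field; exact C1_nz).
      destruct (quotient_at_0 _ _ (sm_flow_0 _ _ _ t S) D0) as [q [Q0 [Q1 [Q2 Q3]]]].
      { intros w Hw. eexists. eapply sm_flow_deriv; eauto. }
      assert (SP := schwarz_pick q Q2 Q3). rewrite Q0, Cmod_RtoC_pos in SP by lra.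
      specialize (SP (proj2 Ht)).
      assert (B : forall w, Cmod w < 1 -> Cmod (q w) <= 1).
      { intros w Hw. destruct (Ceq_dec w (RtoC 0)) as [->|Nw].
        - rewrite Q0, Cmod_RtoC_pos; lra.
        - pose proof (sm_flow_le _ _ _ w t S Hw Ht1) as T. rewrite Q1, Cmod_mult in T.
          apply Cmod_pos in Nw. nra. }
      specialize (SP B z (proj2 Hz)).
      assert (Eq : q z = (RtoC 1 + c (RtoC t) * (RtoC t - RtoC 1) / z)%C).
      { rewrite <- Hc, Q1. field. exact Nz. }
      rewrite Eq in SP.
      replace (Cconj (RtoC t)) with (RtoC t) in SP by (unfold Cconj, RtoC; simpl; f_equal; ring).
      replace (RtoC 1 + c (RtoC t) * (RtoC t - RtoC 1) / z - RtoC t)%C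
        with (RtoC (1 - t) * (RtoC 1 - c (RtoC t) / z))%C in SP by (rewrite RtoC_minus; field; exact Nz).
      replace (RtoC 1 - RtoC t * (RtoC 1 + c (RtoC t) * (RtoC t - RtoC 1) / z))%C
        with (RtoC (1 - t) * (RtoC 1 + RtoC t * c (RtoC t) / z))%C in SP by (rewrite RtoC_minus; field; exact Nz).
      rewrite !Cmod_mult, Cmod_RtoC_pos in SP by lra.
      rewrite Cmod_mult. apply Rmult_le_reg_l with (1 - t); lra. }
  rewrite Ec in L.
  (* For [p = z h' / h], the limit reads [|1 - 1/p| <= |z| |1 + 1/p|]; multiply by [|p|]. *)
  replace (z * h' z / h z - RtoC 1)%C with ((z * h' z / h z) * (RtoC 1 - h z / h' z / z))%C
    by (field; auto).
  replace (z * h' z / h z + RtoC 1)%C with ((z * h' z / h z) * (RtoC 1 + RtoC 1 * (h z / h' z) / z))%C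
    by (field; auto).
  rewrite Cmod_mult in L. rewrite !(Cmod_mult (z * h' z / h z)).
  pose proof (Cmod_ge_0 (z * h' z / h z)). nra.
Qed.

(* The derivative of [g o k] along the segment from [t * h z] to [h z] is [g' / h'] at points of the
   disc. *)
Lemma sm_segment_bound (h h' k g g' : C -> C) (z : C) (t : R) : starlike_map h h' k ->
  (forall w, Cmod w < 1 -> cderiv g w (g' w)) ->
  (forall w, Cmod w < 1 -> Cmod (g' w) <= Cmod (h' w)) ->
  Cmod z < 1 -> 0 <= t <= 1 ->
  Cmod (g z - g (k (RtoC t * h z)%C)) <= (1 - t) * Cmod (h z).
Proof.
  intros S Dg Lg Hz Ht.
  pose proof (mean_value_inequality (fun u => g (k (u * h z)%C)) (fun s => s * Cmod (h z))
    (fun _ => Cmod (h z)) t 1 (proj2 Ht)) as M. cbv beta in M.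
  rewrite Cmult_1_l, (sm_k _ _ _ S z Hz) in M.
  replace ((1 - t) * Cmod (h z)) with (1 * Cmod (h z) - t * Cmod (h z)) by ring. apply M.
  - intros s Hs. assert (Hs' : 0 <= s <= 1) by lra.
    destruct (sm_star _ _ _ S z s Hz Hs') as [H1 H2].
    eexists. split.
    + apply cderiv_comp; [eapply sm_ray_deriv; eauto|apply Dg, H1].
    + assert (N := sm_neq _ _ _ S _ H1). specialize (Lg _ H1).
      rewrite Cmod_mult, Cmod_div by exact N. apply Cmod_pos in N.
      set (a := Cmod (h' _)) in *. pose proof (Cmod_ge_0 (h z)).
      replace (Cmod (h z)) with (a * (Cmod (h z) / a)) at 2 by (field; lra).
      apply Rmult_le_compat_r; [|exact Lg]. apply Rle_div_r; lra.
  - intros s _. auto_derive; [exact I|ring].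
Qed.

(* Schwarz-Pick for [(g z - g (k (t * h z))) / ((1 - t) * h z)], whose modulus is at most 1 and whose
   value at 0 is [g' 0]. *)
Lemma sm_secant_schwarz_pick (h h' k g g' : C -> C) (z : C) (t : R) : starlike_map h h' k ->
  (forall w, Cmod w < 1 -> cderiv g w (g' w)) ->
  (forall w, Cmod w < 1 -> Cmod (g' w) <= Cmod (h' w)) ->
  Cmod (g' (RtoC 0)) < 1 ->
  0 < Cmod z < 1 -> 0 <= t < 1 ->
  let q := ((g z - g (k (RtoC t * h z)%C)) / (RtoC (1 - t) * h z))%C in
  Cmod (q - g' (RtoC 0)) <= Cmod z * Cmod (RtoC 1 - Cconj (g' (RtoC 0)) * q).
Proof.
  intros S Dg Lg G0 Hz Ht q.
  assert (Ht1 : 0 <= t <= 1) by lra.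
  assert (N1 : RtoC (1 - t) <> RtoC 0) by (apply Cmod_pos_neq; rewrite Cmod_RtoC_pos; lra).
  set (f := fun w => (g w - g (k (RtoC t * h w)%C))%C).
  assert (Df : forall w, Cmod w < 1 -> cderiv f w
    (g' w - g' (k (RtoC t * h w)%C) * (RtoC t * h' w / h' (k (RtoC t * h w)%C)))%C).
  { intros w Hw. apply cderiv_minus; [apply Dg, Hw|].
    apply (cderiv_comp (fun v => k (RtoC t * h v)%C) g); [eapply sm_flow_deriv; eauto|].
    apply Dg, (sm_star _ _ _ S w t Hw Ht1). }
  assert (F0 : f (RtoC 0) = RtoC 0).
  { unfold f. rewrite (sm_flow_0 _ _ _ t S). ring. }
  pose proof (Df _ Cmod_0_lt_1) as D0. rewrite (sm_flow_0 _ _ _ t S), (sm_1 _ _ _ S) in D0.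
  destruct (quotient_at_0 f _ F0 D0) as [p [P0 [P1 [P2 P3]]]]; [eauto|].
  pose proof (sm_deriv _ _ _ S _ Cmod_0_lt_1) as H0. rewrite (sm_1 _ _ _ S) in H0.
  destruct (quotient_at_0 h _ (sm_0 _ _ _ S) H0) as [x [X0 [X1 [X2 X3]]]].
  { intros w Hw. eexists. apply (sm_deriv _ _ _ S w Hw). }
  assert (Nx : forall w, Cmod w < 1 -> (RtoC (1 - t) * x w)%C <> RtoC 0).
  { intros w Hw. apply Cmult_neq_0; [exact N1|].
    destruct (Ceq_dec w (RtoC 0)) as [->|Nw]; [rewrite X0; exact C1_nz|].
    intros E. apply (sm_h_neq _ _ _ w S); [split; [apply Cmod_pos, Nw|exact Hw]|].
    rewrite X1, E. ring. }
  (* Numerator and denominator are divided by [w], which gives the secant a value at 0: the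
     derivative of [f] there is [(1 - t) g'(0)], so that [y 0 = g'(0)]. *)
  set (y := fun w => (p w / (RtoC (1 - t) * x w))%C).
  assert (Y0 : y (RtoC 0) = g' (RtoC 0)).
  { unfold y. rewrite P0, X0, RtoC_minus. rewrite RtoC_minus in N1. field. exact N1. }
  assert (Yq : forall w, 0 < Cmod w < 1 -> y w = (f w / (RtoC (1 - t) * h w))%C).
  { intros w Hw. unfold y. rewrite P1, X1. field.
    assert (Nxw := Nx w (proj2 Hw)). split; [|split].
    - apply Cmod_pos_neq; lra.
    - intros E. apply Nxw. rewrite E. ring.
    - exact N1. }
  assert (SP : Cmod (y z - y (RtoC 0)) <= Cmod z * Cmod (RtoC 1 - Cconj (y (RtoC 0)) * y z)).
  { apply schwarz_pick; [| | | |apply Hz].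
    - intros w Hw. apply ccont_div; [auto| |auto]. apply ccont_mult; auto using ccont_const.
    - intros w Hw. destruct (P3 w Hw) as [a Ha]. destruct (X3 w Hw) as [b Hb].
      eapply cderiv_div; [exact Ha|apply cderiv_scale, Hb|apply Nx, Hw].
    - rewrite Y0. exact G0.
    - intros w Hw. destruct (Ceq_dec w (RtoC 0)) as [->|Nw]; [rewrite Y0; lra|].
      assert (Hw' : 0 < Cmod w < 1) by (split; [apply Cmod_pos, Nw|exact Hw]).
      assert (Nh := sm_h_neq _ _ _ w S Hw').
      rewrite Yq by exact Hw'. rewrite Cmod_div by (apply Cmult_neq_0; assumption).
      apply Cmod_pos in Nh. rewrite Cmod_mult, Cmod_RtoC_pos by lra.
      apply Rle_div_l; [nra|]. rewrite Rmult_1_l. eapply sm_segment_bound; eauto. }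
  rewrite Y0, Yq in SP by exact Hz. exact SP.
Qed.

(** If [c] is the slope at [u = 1] of [g (k (u h(z)))], the secant for [t] is [c(t) / h(z)] and its
    limit is [c(1) / h(z) = g'(z) / h'(z)]. *)
Lemma sm_dilatation_schwarz_pick (h h' k g g' : C -> C) (z : C) : starlike_map h h' k ->
  (forall w, Cmod w < 1 -> cderiv g w (g' w)) ->
  (forall w, Cmod w < 1 -> Cmod (g' w) <= Cmod (h' w)) ->
  Cmod (g' (RtoC 0)) < 1 ->
  0 < Cmod z < 1 ->
  Cmod (g' z / h' z - g' (RtoC 0)) <=
    Cmod z * Cmod (RtoC 1 - Cconj (g' (RtoC 0)) * (g' z / h' z)).
Proof.
  intros S Dg Lg G0 Hz.
  assert (Nh := sm_h_neq _ _ _ z S Hz). assert (Nh' := sm_neq _ _ _ S z (proj2 Hz)).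
  assert (D1 : cderiv (fun u => g (k (u * h z)%C)) (RtoC 1) (g' z * (h z / h' z))%C).
  { pose proof (sm_ray_deriv _ _ _ z 1 S (proj2 Hz) ltac:(lra)) as D.
    rewrite Cmult_1_l, (sm_k _ _ _ S z (proj2 Hz)) in D.
    apply cderiv_comp; [exact D|]. rewrite Cmult_1_l, (sm_k _ _ _ S z (proj2 Hz)).
    apply Dg, Hz. }
  apply cderiv_carath in D1. destruct D1 as [c [Ec [Kc Hc]]].
  rewrite Cmult_1_l, (sm_k _ _ _ S z (proj2 Hz)) in Hc.
  set (b := g' (RtoC 0)) in *.
  assert (L : Cmod (c (RtoC 1) / h z - b) <= Cmod (z * (RtoC 1 - Cconj b * (c (RtoC 1) / h z)))).
  { assert (K : ccont (fun u => c u / h z)%C (RtoC 1)) by (apply ccont_div; auto using ccont_const).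
    apply (Cmod_le_limit (fun u => c u / h z - b)%C (fun u => z * (RtoC 1 - Cconj b * (c u / h z)))%C).
    - apply ccont_minus; auto using ccont_const.
    - apply ccont_mult; [apply ccont_const|]. apply ccont_minus; [apply ccont_const|].
      apply ccont_mult; auto using ccont_const.
    - intros d Hd. destruct (exists_near_1 d Hd) as [t [Ht Ht']]. exists (RtoC t). split; [exact Ht'|].
      pose proof (sm_secant_schwarz_pick h h' k g g' z t S Dg Lg G0 Hz Ht) as SP.
      cbv zeta in SP. fold b in SP.
      assert (N1 : RtoC (1 - t) <> RtoC 0) by (apply Cmod_pos_neq; rewrite Cmod_RtoC_pos; lra).
      replace ((g z - g (k (RtoC t * h z)%C)) / (RtoC (1 - t) * h z))%C with (c (RtoC t) / h z)%C in SP.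
      + rewrite Cmod_mult. exact SP.
      + replace (g z - g (k (RtoC t * h z)%C))%C with (- (g (k (RtoC t * h z)%C) - g z))%C by ring.
        rewrite Hc. rewrite RtoC_minus in *. field. split; assumption. }
  rewrite Ec, Cmod_mult in L.
  replace (g' z * (h z / h' z) / h z)%C with (g' z / h' z)%C in L by (field; auto). exact L.
Qed.

(** * Growth and distortion *)

(** The hypothesis places [q] in the Apollonius disc whose diameter is the real segment from
    [(1 - r) / (1 + r)] to [(1 + r) / (1 - r)]. *)
Lemma log_derivative_bounds (q : C) (r : R) : 0 <= r < 1 ->
  Cmod (q - RtoC 1) <= r * Cmod (q + RtoC 1) ->
  Cmod q * (1 - r) <= 1 + r /\ 1 - r <= Re q * (1 + r).
Proof.
  intros Hr H. split.
  - pose proof (Cmod_sub_ge q (RtoC 1)) as T1. pose proof (Cmod_triangle q (RtoC 1)) as T2.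
    rewrite Cmod_1 in T1, T2. nra.
  - assert (H2 : Cmod (q - RtoC 1) * Cmod (q - RtoC 1) <= (r * Cmod (q + RtoC 1)) * (r * Cmod (q + RtoC 1)))
      by (apply Rmult_le_compat; auto using Cmod_ge_0).
    replace ((r * Cmod (q + RtoC 1)) * (r * Cmod (q + RtoC 1)))
      with (r * r * (Cmod (q + RtoC 1) * Cmod (q + RtoC 1))) in H2 by ring.
    rewrite !Cmod2_Re_Im in H2. destruct q as [x y]. unfold Re, Im in *; simpl in *.
    assert (0 <= y * y) by nra. assert (r * r < 1) by nra.
    assert (P : (x * (1 - r) - (1 + r)) * (x * (1 + r) - (1 - r)) <= 0) by nra.
    apply Rnot_lt_le. intros L.
    assert (x * (1 - r) < 1 + r).
    { apply Rmult_lt_reg_r with (1 + r); [lra|]. nra. }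
    nra.
Qed.

Lemma cderiv_ray (f : C -> C) (e l : C) (s : R) : cderiv f (RtoC s * e)%C l ->
  cderiv (fun u => f (u * e)%C) (RtoC s) (l * e)%C.
Proof.
  intros D. apply (cderiv_comp (fun u => u * e)%C f); [|exact D].
  pose proof (cderiv_mult _ _ (RtoC s) _ _ (cderiv_id (RtoC s)) (cderiv_const e (RtoC s))) as M.
  cbv beta in M. replace (RtoC 1 * e + RtoC s * RtoC 0)%C with e in M by ring. exact M.
Qed.

(** The squared modulus is polynomial in real and imaginary parts; the imaginary part is written
    [Re (- Ci * F)], so that [cderiv_Re] serves for both. *)
Lemma Cmod2_ray_deriv (f : C -> C) (e l : C) (s : R) : cderiv f (RtoC s * e)%C l ->
  is_derive (fun t => Cmod (f (RtoC t * e)%C) * Cmod (f (RtoC t * e)%C)) s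
    (2 * Re (Cconj (f (RtoC s * e)%C) * (l * e))).
Proof.
  intros D. apply cderiv_ray in D.
  pose proof (cderiv_Re _ _ _ D) as DR.
  pose proof (cderiv_Re _ _ _ (cderiv_scale _ _ _ (- Ci)%C D)) as DI.
  apply (is_derive_ext (fun t => Re (f (RtoC t * e)%C) * Re (f (RtoC t * e)%C)
     + Re (- Ci * f (RtoC t * e)%C)%C * Re (- Ci * f (RtoC t * e)%C)%C)).
  { intros t. rewrite Cmod2_Re_Im. destruct (f (RtoC t * e)%C). unfold Re, Im, Ci; simpl. ring. }
  evar_last.
  - apply @is_derive_plus; apply Derive.is_derive_mult; try exact DR; exact DI.
  - unfold plus, Re, Im, Ci, Cconj; simpl. ring.
Qed.

Lemma ray_coordinates (z : C) : 0 < Cmod z < 1 ->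
  exists e, Cmod e = 1 /\ (RtoC (Cmod z) * e)%C = z.
Proof.
  intros Hz. assert (N : RtoC (Cmod z) <> RtoC 0) by (apply Cmod_pos_neq; rewrite Cmod_RtoC_pos; lra).
  exists (z / RtoC (Cmod z))%C. split; [|field; exact N].
  rewrite Cmod_div, Cmod_RtoC_pos by (auto; lra). field. lra.
Qed.

Lemma Cmod_ray (e : C) (s : R) : Cmod e = 1 -> 0 <= s -> Cmod (RtoC s * e) = s.
Proof. intros He Hs. rewrite Cmod_mult, He, Cmod_RtoC_pos by exact Hs. ring. Qed.

(* Along a ray, [|h|^2 (1 - s)^4 / s^2] decreases and [|h|^2 (1 + s)^4 / s^2] increases; both tend to
   [|h' 0|^2 = 1] at 0. *)
Lemma sm_growth (h h' k : C -> C) (z : C) : starlike_map h h' k -> 0 < Cmod z < 1 ->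
  Cmod (h z) * (1 - Cmod z) ^ 2 <= Cmod z <= Cmod (h z) * (1 + Cmod z) ^ 2.
Proof.
  intros S Hz. destruct (ray_coordinates z Hz) as [e [He Ez]].
  set (r := Cmod z) in *.
  set (L := fun s => Cmod (h (RtoC s * e)%C) * Cmod (h (RtoC s * e)%C)).
  assert (DL : forall s, 0 < s < 1 -> exists q, is_derive L s (2 * L s * q / s) /\
     q * (1 - s) <= 1 + s /\ 1 - s <= q * (1 + s)).
  { intros s Hs. assert (Hw : Cmod (RtoC s * e) = s) by (apply Cmod_ray; lra).
    set (w := (RtoC s * e)%C) in *. assert (Hw' : 0 < Cmod w < 1) by lra.
    pose proof (sm_log_derivative _ _ _ w S Hw') as B. rewrite Hw in B.
    assert (Nh := sm_h_neq _ _ _ w S Hw').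
    set (q := (w * h' w / h w)%C) in *.
    destruct (log_derivative_bounds q s) as [B1 B2]; [lra|exact B|].
    pose proof (re_le_Cmod q) as R1. apply Rabs_le_between in R1.
    exists (Re q). split; [|split; [nra|exact B2]].
    pose proof (Cmod2_ray_deriv h e (h' w) s (sm_deriv _ _ _ S w (proj2 Hw'))) as D.
    fold w in D. replace (2 * L s * Re q / s) with (2 * Re (Cconj (h w) * (h' w * e))); [exact D|].
    (* Multiplying by [s] turns [e] into [w], and [conj (h w) * w * h' w = |h w|^2 q]. *)
    assert (Q : (RtoC s * (Cconj (h w) * (h' w * e)))%C = (RtoC (L s) * q)%C).
    { unfold L. fold w. replace (Cmod (h w) * Cmod (h w)) with (Cmod (h w) ^ 2) by ring.
      rewrite Cmod2_conj. unfold q.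
      change (w * h' w / h w)%C with (RtoC s * e * h' w / h w)%C. field. exact Nh. }
    apply (f_equal Re) in Q. rewrite !re_scal_l in Q.
    replace (2 * L s * Re q / s) with (2 * (L s * Re q) / s) by (field; lra).
    rewrite <- Q. field. lra. }
  assert (LP : forall s, 0 <= L s) by (intros s; apply Rmult_le_pos; apply Cmod_ge_0).
  assert (Mono : forall s, 0 < s < r ->
    L r * (1 - r) ^ 4 / r ^ 2 <= L s * (1 - s) ^ 4 / s ^ 2 /\
    L s * (1 + s) ^ 4 / s ^ 2 <= L r * (1 + r) ^ 4 / r ^ 2).
  { intros s Hs.
    set (qf := fun t => epsilon (inhabits 0) (fun q => is_derive L t (2 * L t * q / t) /\
      q * (1 - t) <= 1 + t /\ 1 - t <= q * (1 + t))).
    assert (Q : forall t, 0 < t < 1 -> is_derive L t (2 * L t * qf t / t) /\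
      qf t * (1 - t) <= 1 + t /\ 1 - t <= qf t * (1 + t)).
    { intros t Ht. unfold qf. apply epsilon_spec. apply DL, Ht. }
    assert (P3 : forall t c, 0 < t -> 0 < c -> 0 <= 2 * L t * c ^ 3 / t ^ 3).
    { intros t c Ht Hc. apply Rle_div_r. apply pow_lt; lra. rewrite Rmult_0_l.
      apply Rmult_le_pos; [pose proof (LP t); lra|]. apply pow_le; lra. }
    assert (HL : forall t, 0 < t < 1 -> forall m dm, is_derive m t dm ->
      is_derive (fun t => L t * m t) t (2 * L t * qf t / t * m t + L t * dm)).
    { intros t Ht m dm Dm. apply Derive.is_derive_mult; [apply Q, Ht|exact Dm]. }
    split.
    - apply Ropp_le_cancel.
      (* The derivative carries the factor [1 + t - qf t * (1 - t)], and its counterpart below the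
         factor [qf t * (1 + t) - (1 - t)]: the two bounds on [qf] are precisely their signs. *)
      pose proof (increasing_of_derive (fun t => - (L t * ((1 - t) ^ 4 / t ^ 2)))
        (fun t => (2 * L t * (1 - t) ^ 3 / t ^ 3) * (1 + t - qf t * (1 - t))) s r) as I.
      assert (I' : - (L s * ((1 - s) ^ 4 / s ^ 2)) <= - (L r * ((1 - r) ^ 4 / r ^ 2))).
      { apply I; [lra| |].
        - intros t Ht. evar_last.
          + apply (is_derive_opp (fun t => L t * ((1 - t) ^ 4 / t ^ 2))).
            apply (HL t ltac:(lra) (fun t => (1 - t) ^ 4 / t ^ 2)
              (- (4 * (1 - t) ^ 3) / t ^ 2 - 2 * (1 - t) ^ 4 / t ^ 3)).
            auto_derive; [apply Rgt_not_eq; nra|field; lra].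
          + unfold opp; simpl. field. lra.
        - intros t Ht. apply Rmult_le_pos; [apply P3; lra|].
          destruct (Q t ltac:(lra)) as [_ [Q1 Q2]]. lra. }
      unfold Rdiv in *. lra.
    - pose proof (increasing_of_derive (fun t => (L t * ((1 + t) ^ 4 / t ^ 2)))
        (fun t => (2 * L t * (1 + t) ^ 3 / t ^ 3) * (qf t * (1 + t) - (1 - t))) s r) as I.
      assert (I' : (L s * ((1 + s) ^ 4 / s ^ 2)) <= (L r * ((1 + r) ^ 4 / r ^ 2))).
      { apply I; [lra| |].
        - intros t Ht. evar_last.
          + apply (HL t ltac:(lra) (fun t => (1 + t) ^ 4 / t ^ 2)
              (4 * (1 + t) ^ 3 / t ^ 2 - 2 * (1 + t) ^ 4 / t ^ 3)).
            auto_derive; [apply Rgt_not_eq; nra|field; lra].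
          + field. lra.
        - intros t Ht. apply Rmult_le_pos; [apply P3; lra|].
          destruct (Q t ltac:(lra)) as [_ [Q1 Q2]]. lra. }
      unfold Rdiv in *. lra. }
  pose proof (sm_deriv _ _ _ S _ Cmod_0_lt_1) as H0. rewrite (sm_1 _ _ _ S) in H0.
  destruct (quotient_at_0 h _ (sm_0 _ _ _ S) H0) as [x [X0 [X1 [X2 _]]]].
  { intros w Hw. eexists. apply (sm_deriv _ _ _ S w Hw). }
  assert (Lx : forall s, 0 < s -> L s / s ^ 2 = Cmod (x (RtoC s * e)%C) ^ 2).
  { intros s Hs. unfold L. rewrite X1, Cmod_mult, Cmod_ray by lra. field. lra. }
  assert (Mono2 : forall s, 0 < s < r ->
    Cmod (x z) * (1 - r) ^ 2 <= Cmod (x (RtoC s * e)%C) * (1 - s) ^ 2 /\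
    Cmod (x (RtoC s * e)%C) * (1 + s) ^ 2 <= Cmod (x z) * (1 + r) ^ 2).
  { intros s Hs. destruct (Mono s Hs) as [M1 M2].
    assert (E : forall t c, 0 < t -> L t * c ^ 4 / t ^ 2 = Rsqr (Cmod (x (RtoC t * e)%C) * c ^ 2)).
    { intros t c Ht. replace (L t * c ^ 4 / t ^ 2) with (L t / t ^ 2 * c ^ 4) by (field; lra).
      rewrite (Lx t Ht). unfold Rsqr. ring. }
    rewrite !E in M1, M2 by lra. rewrite Ez in M1, M2.
    split; (apply Rsqr_incr_0_var; [assumption|]);
      (apply Rmult_le_pos; [apply Cmod_ge_0|]); apply pow2_ge_0. }
  assert (Kx : ccont x (RtoC 0)) by (apply X2, Cmod_0_lt_1).
  (* Here [x w] is [h w / w] extended to 0. The sign [sg] is [-1] for the upper growth bound and [1]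
     for the lower one; the weight is the square of [1 + sg |w|], as a complex function. *)
  assert (Ks : forall sg, ccont (fun w => x w * ((RtoC 1 + RtoC sg * RtoC (Cmod w)) * (RtoC 1 + RtoC sg * RtoC (Cmod w))))%C (RtoC 0)).
  { intros sg.
    assert (ccont (fun w => RtoC 1 + RtoC sg * RtoC (Cmod w))%C (RtoC 0)).
    { apply ccont_plus; [apply ccont_const|]. apply ccont_mult; [apply ccont_const|].
      apply ccont_Cmod, ccont_id. }
    apply ccont_mult; [exact Kx|apply ccont_mult; assumption]. }
  assert (Es : forall sg s v, 0 < s < 1 -> -1 <= sg <= 1 ->
    Cmod (v * ((RtoC 1 + RtoC sg * RtoC s) * (RtoC 1 + RtoC sg * RtoC s))) = Cmod v * (1 + sg * s) ^ 2).
  { intros sg s v Hs Hsg. rewrite <- RtoC_mult, <- RtoC_plus, !Cmod_mult, Cmod_RtoC_pos by nra. ring. }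
  assert (E0 : forall sg, Cmod (x (RtoC 0) * ((RtoC 1 + RtoC sg * RtoC (Cmod (RtoC 0))) * (RtoC 1 + RtoC sg * RtoC (Cmod (RtoC 0))))) = 1).
  { intros sg. rewrite X0, Cmod_0. replace (RtoC 1 * ((RtoC 1 + RtoC sg * RtoC 0) * (RtoC 1 + RtoC sg * RtoC 0)))%C with (RtoC 1) by ring.
    apply Cmod_1. }
  assert (Near : forall d, 0 < d -> exists s, 0 < s < r /\ Cmod (RtoC s * e - RtoC 0) < d).
  { intros d Hd. exists (Rmin d r / 2). pose proof (Rmin_l d r). pose proof (Rmin_r d r).
    assert (0 < Rmin d r) by (apply Rmin_pos; lra). split; [lra|].
    replace (RtoC (Rmin d r / 2) * e - RtoC 0)%C with (RtoC (Rmin d r / 2) * e)%C by ring.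
    rewrite Cmod_ray by (auto; lra). lra. }
  rewrite (X1 z), Cmod_mult. fold r.
  assert (U : Cmod (x z) * (1 - r) ^ 2 <= 1).
  { assert (T : Cmod (x z * ((RtoC 1 + RtoC (-1) * RtoC r) * (RtoC 1 + RtoC (-1) * RtoC r)))
      <= Cmod (x (RtoC 0) * ((RtoC 1 + RtoC (-1) * RtoC (Cmod (RtoC 0))) * (RtoC 1 + RtoC (-1) * RtoC (Cmod (RtoC 0)))))).
    { refine (Cmod_le_limit (fun _ => _) _ _ (ccont_const _ _) (Ks (-1)) _).
      intros d Hd. destruct (Near d Hd) as [s [Hs Hs']]. exists (RtoC s * e)%C. split; [exact Hs'|].
      rewrite Cmod_ray, !Es by (auto; lra). destruct (Mono2 s Hs) as [M _].
      replace (1 + -1 * r) with (1 - r) by ring. replace (1 + -1 * s) with (1 - s) by ring. exact M. }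
    rewrite E0, Es in T by lra. replace (1 - r) with (1 + -1 * r) by ring. exact T. }
  assert (V : 1 <= Cmod (x z) * (1 + r) ^ 2).
  { assert (T : Cmod (x (RtoC 0) * ((RtoC 1 + RtoC 1 * RtoC (Cmod (RtoC 0))) * (RtoC 1 + RtoC 1 * RtoC (Cmod (RtoC 0)))))
      <= Cmod (x z * ((RtoC 1 + RtoC 1 * RtoC r) * (RtoC 1 + RtoC 1 * RtoC r)))).
    { refine (Cmod_le_limit _ (fun _ => _) _ (Ks 1) (ccont_const _ _) _).
      intros d Hd. destruct (Near d Hd) as [s [Hs Hs']]. exists (RtoC s * e)%C. split; [exact Hs'|].
      rewrite Cmod_ray, !Es by (auto; lra). destruct (Mono2 s Hs) as [_ M].
      replace (1 + 1 * r) with (1 + r) by ring. replace (1 + 1 * s) with (1 + s) by ring. exact M. }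
    rewrite E0, Es in T by lra. replace (1 + r) with (1 + 1 * r) by ring. exact T. }
  split; nra.
Qed.

(** The product of [|z h' / h| <= (1 + r) / (1 - r)] and the growth bound [|h| <= r / (1 - r)^2],
    divided by [r]; at 0 the normalisation gives equality. *)
Lemma sm_distortion (h h' k : C -> C) (z : C) : starlike_map h h' k -> Cmod z < 1 ->
  Cmod (h' z) <= (1 + Cmod z) / (1 - Cmod z) ^ 3.
Proof.
  intros S Hz1. assert (P3 : 0 < (1 - Cmod z) ^ 3) by (apply pow_lt; lra).
  destruct (Ceq_dec z (RtoC 0)) as [->|Nz].
  { rewrite (sm_1 _ _ _ S), Cmod_1, Cmod_0. right. field. }
  assert (Hz : 0 < Cmod z < 1) by (split; [apply Cmod_pos, Nz|exact Hz1]).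
  destruct (sm_growth _ _ _ z S Hz) as [G _].
  pose proof (sm_log_derivative _ _ _ z S Hz) as B.
  assert (Nh := sm_h_neq _ _ _ z S Hz).
  destruct (log_derivative_bounds _ (Cmod z) ltac:(lra) B) as [B1 _].
  rewrite Cmod_div, Cmod_mult in B1 by exact Nh. apply Cmod_pos in Nh.
  apply Rle_div_r; [exact P3|].
  set (r := Cmod z) in *. set (a := Cmod (h z)) in *. set (d := Cmod (h' z)) in *.
  assert (B2 : r * d * (1 - r) <= (1 + r) * a).
  { replace (r * d * (1 - r)) with (r * d / a * (1 - r) * a) by (field; lra).
    apply Rmult_le_compat_r; lra. }
  apply Rmult_le_reg_l with r; [lra|].
  assert (0 <= (1 - r) ^ 2) by apply pow2_ge_0.
  apply Rle_trans with ((1 + r) * a * (1 - r) ^ 2); [|nra].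
  replace (r * (d * (1 - r) ^ 3)) with (r * d * (1 - r) * (1 - r) ^ 2) by ring.
  apply Rmult_le_compat_r; assumption.
Qed.

(** * The explicit upper bound *)

(** The primitive vanishing at 0 of [(a + s) / (1 + a s) * ((1 + s) / (1 - s)^3)], found by partial
    fractions. *)
Definition coanalytic_bound (a s : R) : R :=
  ((1 - a) / (1 + a)) ^ 2 * ln ((1 + a * s) / (1 - s)) + s / (1 - s) ^ 2
  - (1 - a) / (1 + a) * (2 * s / (1 - s)).

Lemma coanalytic_bound_0 (a : R) : coanalytic_bound a 0 = 0.
Proof.
  unfold coanalytic_bound. replace ((1 + a * 0) / (1 - 0)) with 1 by field.
  rewrite ln_1. unfold Rdiv. ring.
Qed.

Lemma coanalytic_bound_deriv (a s : R) : 0 <= a -> 0 <= s < 1 ->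
  is_derive (coanalytic_bound a) s ((a + s) / (1 + a * s) * ((1 + s) / (1 - s) ^ 3)).
Proof.
  intros Ha Hs. assert (0 <= a * s) by nra. unfold coanalytic_bound.
  auto_derive.
  - repeat split; try nra. apply Rdiv_lt_0_compat; lra.
  - field. repeat split; try lra.
Qed.

(** Integration by parts: the right side is [omega K] with [omega(s) = (a + s) / (1 + a s)] and
    [K(s) = s / (1 - s)^2], and [coanalytic_bound] has derivative [omega K']. The difference has
    derivative [omega' K], where [omega'(s) = (1 - a^2) / (1 + a s)^2]. *)
Lemma coanalytic_bound_le (a r : R) : 0 <= a < 1 -> 0 <= r < 1 ->
  coanalytic_bound a r <= r * (a + r) / ((1 + a * r) * (1 - r) ^ 2).
Proof.
  intros Ha Hr.
  pose proof (increasing_of_derive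
    (fun s => s * (a + s) / ((1 + a * s) * (1 - s) ^ 2) - coanalytic_bound a s)
    (fun s => (1 - a * a) / (1 + a * s) ^ 2 * (s / (1 - s) ^ 2)) 0 r (proj1 Hr)) as I.
  cbv beta in I. rewrite coanalytic_bound_0 in I.
  replace (0 * (a + 0) / ((1 + a * 0) * (1 - 0) ^ 2)) with 0 in I by (field; lra).
  assert (forall x y : R, 0 - 0 <= x - y -> y <= x) as E by (intros; lra). apply E, I.
  - intros s Hs. assert (0 <= a * s) by nra. evar_last.
    + apply (is_derive_minus (fun s => s * (a + s) / ((1 + a * s) * (1 - s) ^ 2)));
        [|apply coanalytic_bound_deriv; lra].
      auto_derive; [|reflexivity].
      apply Rgt_not_eq. repeat apply Rmult_gt_0_compat; lra.
    + unfold minus, plus, opp; simpl. field. lra.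
  - intros s Hs. assert (0 <= a * s) by nra.
    apply Rmult_le_pos; apply Rle_div_r; try (apply pow_lt; lra); nra.
Qed.

(** Positivity of the Jacobian is [|g'| < |h'|], which also keeps [h'] away from 0 and so makes the
    inverse of [h] differentiable. *)
Lemma L_H_starlike_map (alpha : R) (f h g : C -> C) : L_H_starlike alpha f h g ->
  exists h' k g', starlike_map h h' k /\ g (RtoC 0) = RtoC 0 /\
    (forall z, Cmod z < 1 -> cderiv g z (g' z)) /\
    (forall z, Cmod z < 1 -> Cmod (g' z) <= Cmod (h' z)) /\ Cmod (g' (RtoC 0)) = alpha.
Proof.
  intros [[[Ah [Ag [G0 _]]] [_ [SP [H0 H1]]]] [Ea [_ [Inj [_ St]]]]].
  assert (Dh : forall z, Cmod z < 1 -> cderiv h z (C_derive h z)).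
  { intros z Hz. apply is_derive_cderiv, C_derive_correct; [exact z|exact (Ah z Hz)]. }
  assert (J : forall z, Cmod z < 1 -> Cmod (C_derive g z) < Cmod (C_derive h z)).
  { intros z Hz. specialize (SP z Hz). unfold jacobian in SP.
    apply Rnot_le_lt. intros L. pose proof (Cmod_ge_0 (C_derive h z)). nra. }
  assert (Nh : forall z, Cmod z < 1 -> C_derive h z <> RtoC 0).
  { intros z Hz. apply Cmod_pos_neq. specialize (J z Hz). pose proof (Cmod_ge_0 (C_derive g z)). lra. }
  destruct (holomorphic_inverse h (C_derive h) Dh Nh Inj) as [k [K1 K2]].
  exists (C_derive h), k, (C_derive g). split; [|split; [exact G0|split; [|split; [|exact Ea]]]].
  - constructor; auto. intros z t Hz Ht.
    destruct (St (h z) t) as [v [Hv Ev]]; [exists z; auto|exact Ht|].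
    rewrite <- Ev, (K1 v Hv). auto.
  - intros z Hz. apply is_derive_cderiv, C_derive_correct; [exact z|exact (Ag z Hz)].
  - intros z Hz. left. apply J, Hz.
Qed.

Theorem theorem2p7 (alpha : R) (halpha : 0 <= alpha < 1)
    (f h g : C -> C) (hf : L_H_starlike alpha f h g) :
  forall z : C, unit_disc z ->
    (if Rlt_dec (Cmod z) alpha
     then Cmod z * (alpha - Cmod z) /
            ((1 - alpha * Cmod z) * (1 + Cmod z) ^ 2)
     else 0) <= Cmod (g z) /\
    Cmod (g z) <=
      ((1 - alpha) / (1 + alpha)) ^ 2 *
        ln ((1 + alpha * Cmod z) / (1 - Cmod z))
      + Cmod z / (1 - Cmod z) ^ 2
      - (1 - alpha) / (1 + alpha) * (2 * Cmod z / (1 - Cmod z))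
    <= Cmod z * (alpha + Cmod z) /
         ((1 + alpha * Cmod z) * (1 - Cmod z) ^ 2).
Proof.
  intros z Hz1. unfold unit_disc in Hz1. pose proof (Cmod_ge_0 z) as Hz0.
  destruct (L_H_starlike_map _ _ _ _ hf) as [h' [k [g' [S [G0 [Dg [Lg Ea]]]]]]].
  assert (Ga : Cmod (g' (RtoC 0)) < 1) by lra.
  change (((1 - alpha) / (1 + alpha)) ^ 2 * ln ((1 + alpha * Cmod z) / (1 - Cmod z))
      + Cmod z / (1 - Cmod z) ^ 2 - (1 - alpha) / (1 + alpha) * (2 * Cmod z / (1 - Cmod z)))
    with (coanalytic_bound alpha (Cmod z)).
  split; [|split; [|apply coanalytic_bound_le; lra]].
  - destruct (Rlt_dec (Cmod z) alpha) as [Hr|Hr]; [|apply Cmod_ge_0].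
    destruct (Ceq_dec z (RtoC 0)) as [->|Nz].
    { rewrite G0, Cmod_0. right. field. }
    assert (Hz : 0 < Cmod z < 1) by (split; [apply Cmod_pos, Nz|exact Hz1]).
    (* For [t = 0] the segment starts at [k 0 = 0], and the secant is [g / h]. *)
    pose proof (sm_secant_schwarz_pick h h' k g g' z 0 S Dg Lg Ga Hz ltac:(lra)) as SP.
    cbv zeta in SP.
    assert (E : ((g z - g (k (RtoC 0 * h z)%C)) / (RtoC (1 - 0) * h z))%C = (g z / h z)%C).
    { assert (K0 := sm_flow_0 _ _ _ 0 S). rewrite (sm_0 _ _ _ S), Cmult_0_r in K0.
      rewrite Cmult_0_l, K0, G0, Rminus_0_r. field. exact (sm_h_neq _ _ _ z S Hz). }
    rewrite E in SP. apply schwarz_pick_bounds in SP; [|exact Ga|lra]. destruct SP as [SP _].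
    assert (Nh := sm_h_neq _ _ _ z S Hz). rewrite Cmod_div, Ea in SP by exact Nh.
    apply Cmod_pos in Nh. destruct (sm_growth _ _ _ z S Hz) as [_ Gr].
    set (r := Cmod z) in *. set (A := Cmod (h z)) in *. set (B := Cmod (g z)) in *.
    assert (0 < 1 - alpha * r) by nra. assert (0 < (1 + r) ^ 2) by (apply pow_lt; lra).
    apply Rle_div_l; [nra|].
    assert (SP' : (alpha - r) * A <= B * (1 - alpha * r)).
    { replace (B * (1 - alpha * r)) with (B / A * (1 - alpha * r) * A) by (field; lra).
      apply Rmult_le_compat_r; lra. }
    (* The growth bound [r <= A (1 + r)^2] may be multiplied by [alpha - r], which is positive in
       this case. *)
    apply Rle_trans with (A * (1 + r) ^ 2 * (alpha - r)); [apply Rmult_le_compat_r; lra|]. nra.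
  - destruct (Ceq_dec z (RtoC 0)) as [->|Nz].
    { rewrite G0, Cmod_0, coanalytic_bound_0. lra. }
    assert (Hz : 0 < Cmod z < 1) by (split; [apply Cmod_pos, Nz|exact Hz1]).
    destruct (ray_coordinates z Hz) as [e [He Ez]].
    pose proof (mean_value_inequality (fun u => g (u * e)%C) (coanalytic_bound alpha)
      (fun s => (alpha + s) / (1 + alpha * s) * ((1 + s) / (1 - s) ^ 3)) 0 (Cmod z) Hz0) as M.
    cbv beta in M. rewrite Ez, Cmult_0_l, G0, coanalytic_bound_0, Rminus_0_r in M.
    replace (g z - RtoC 0)%C with (g z) in M by ring. apply M.
    + intros s Hs. assert (Hw : Cmod (RtoC s * e) = s) by (apply Cmod_ray; lra).
      exists (g' (RtoC s * e) * e)%C. split; [apply cderiv_ray, Dg; lra|].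
      rewrite Cmod_mult, He, Rmult_1_r.
      set (w := (RtoC s * e)%C) in *.
      assert (Hw1 : Cmod w < 1) by lra.
      assert (0 <= alpha * s) by nra.
      (* At the start of the ray the majorant equals [alpha], which is [|g'(0)|]. *)
      destruct (Ceq_dec w (RtoC 0)) as [Ew|Nw].
      { rewrite Ew, Ea. rewrite Ew, Cmod_0 in Hw. rewrite <- Hw. right. field. }
      assert (Hw' : 0 < Cmod w < 1) by (split; [apply Cmod_pos, Nw|exact Hw1]).
      pose proof (sm_dilatation_schwarz_pick h h' k g g' w S Dg Lg Ga Hw') as SP.
      apply schwarz_pick_bounds in SP; [|exact Ga|lra]. destruct SP as [_ SP].
      assert (Nh' := sm_neq _ _ _ S w Hw1). rewrite Cmod_div, Ea, Hw in SP by exact Nh'.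
      pose proof (sm_distortion _ _ _ w S Hw1) as Ds. rewrite Hw in Ds.
      apply Cmod_pos in Nh'.
      apply Rle_div_r in SP; [|lra].
      replace (Cmod (g' w)) with (Cmod (g' w) / Cmod (h' w) * Cmod (h' w)) by (field; lra).
      apply Rmult_le_compat; [|lra|exact SP|exact Ds].
      apply Rle_div_r; [exact Nh'|]. rewrite Rmult_0_l. apply Cmod_ge_0.
    + intros s Hs. apply coanalytic_bound_deriv; lra.
Qed.
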